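(* Let $t_0 = \frac{4}{3}\left(\frac{4}{\sqrt{3}}+1\right)^3$ and fix $t\ge 2t_0$. For every packing $\mathscr{C}$ of $\mathbb{R}^3$ by capped $t$-cylinders, the upper density satisfies $$\rho^+(\mathscr{C}) \le \frac{t+\frac{4}{3}}{\frac{\sqrt{12}}{\pi}(t-2t_0) + 2t_0+\frac{4}{3}}.$$
   Context: A $t$-cylinder is a closed solid circular cylinder in $\mathbb{R}^3$ of unit radius and length $t$. A capped $t$-cylinder is a $t$-cylinder together with solid unit hemispherical caps on its two ends; equivalently, it is the set of points of $\mathbb{R}^3$ at distance at most $1$ from a line segment of length $t$ (its axis). A packing of $\mathbb{R}^3$ by capped $t$-cylinders is a countable family $\mathscr{C}=\{C_i\}_{i\in I}$ of capped $t$-cylinders in $\mathbb{R}^3$ with mutually disjoint interiors. $B(R)$ is the closed ball of radius $R$ centered at $0$. The upper density is $$\rho^+(\mathscr{C})=\limsup_{R\to\infty}\ \sum_{i\in I:\, C_i\subseteq B(R)}\frac{\mathrm{Vol}(C_i)}{\mathrm{Vol}(B(R))}.$$ *)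

(* Defs.v *)
From HB Require Import structures.
From mathcomp Require Export all_boot all_order all_algebra.
From mathcomp Require Export all_classical all_reals all_analysis.
Export numFieldNormedType.Exports.

Set Implicit Arguments.
Unset Strict Implicit.
Unset Printing Implicit Defensive.

Import Order.TTheory GRing.Theory Num.Theory.
Local Open Scope classical_set_scope.
Local Open Scope ring_scope.

(* R^3 is 'rV[R]_3. The library norm `|x| on row vectors is the sup norm, hence
   this Euclidean one; both induce the same topology. *)
Definition enorm (R : realType) (x : 'rV[R]_3) : R :=
  Num.sqrt (\sum_(i < 3) x ord0 i ^+ 2).

Definition edist_set (R : realType) (x : 'rV[R]_3) (A : set 'rV[R]_3) : R :=
  inf [set enorm (x - y) | y in A].

Definition segment (R : realType) (a b : 'rV[R]_3) : set 'rV[R]_3 :=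
  [set (1 - s) *: a + s *: b | s in `[0%R, 1%R]].

Definition is_capped_cylinder (R : realType) (t : R) (C : set 'rV[R]_3) :=
  exists a b : 'rV[R]_3,
    enorm (b - a) = t /\ C = [set x | edist_set x (segment a b) <= 1].

Definition is_packing (R : realType) (t : R) (I : countType)
    (C : I -> set 'rV[R]_3) :=
  (forall i, is_capped_cylinder t (C i)) /\
  trivIset setT (fun i => (C i)°).

Definition vec3 (R : realType) (p : R * R * R) : 'rV[R]_3 :=
  \row_(i < 3) [:: p.1.1; p.1.2; p.2]`_i.

(* Three-dimensional Lebesgue measure: the library provides product measures
   on cartesian products only, hence the transport along vec3. *)
Definition vol (R : realType) (A : set 'rV[R]_3) : \bar R :=
  ((@lebesgue_measure R \x @lebesgue_measure R) \x @lebesgue_measure R)%E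
    (@vec3 R @^-1` A).

Definition eball (R : realType) (r : R) : set 'rV[R]_3 :=
  [set x | enorm x <= r].

(* The limsup is over real radii, and takes values in \bar R. *)
Definition upper_density (R : realType) (I : countType)
    (C : I -> set 'rV[R]_3) : \bar R :=
  limf_esup
    (fun r : R => (\esum_(i in [set i | C i `<=` eball r])
                     (vol (C i) / vol (eball r)))%E)
    (+oo : set_system R).

Definition t0 (R : realType) : R := 4 / 3 * (4 / Num.sqrt 3 + 1) ^+ 3.

(* Main.v *)
Require Import Defs.
From HB Require Import structures.
From mathcomp Require Import measurable_realfun ring lra.
Import Order.TTheory GRing.Theory Num.Theory.
Local Open Scope classical_set_scope.
Local Open Scope ring_scope.

(** Around the axis of each cylinder, consider the points that are closer to
    this axis than to all others and at distance less than rho = 2 / sqrt 3 from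
    it. These truncated Dirichlet cells are disjoint, and the cells of the
    cylinders inside a ball of radius r lie in the ball of radius r + 2. It is
    therefore enough to bound the average volume of a cell from below, and to
    let r grow.

    A cell contains the interior of its capped cylinder, so that its slice
    normal to the axis at any point of the axis has area at least pi. The heart
    of the proof is that the slice at a point x has at least the area 2 sqrt 3
    of the regular hexagon of inradius 1 as soon as x is at distance at least
    2 rho from the ends of all axes (slice_area_ge). Near such an x the other axes behave like lines, and
    the points of the slice that are equidistant from the axis and from such a
    line form a parabola, of which the unit disc around x lies on one side.
    Three points at mutual distances at least 2 do not fit into a ball of radius
    rho with one of them in its interior (no_three_points); hence the directions in which two
    different neighbours come closer than rho to the circle of radius rho around
    x are disjoint, and each neighbour can be treated separately. For one
    neighbour, the parabola must leave at least the proportion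
    2 sqrt 3 / (4 pi / 3) of the circular sector that it spans (planar_sector_bound): what
    remains of the sector contains the triangle under the chord and, when the
    chord meets the unit disc, a parabolic cap that reaches beyond this disc,
    whose area is known from Archimedes' quadrature. The sector spans an angle
    of less than pi / 2, and in this range the resulting inequality between
    functions of the half-angle follows from concavity (sector_scalar_bound).
    Bezdek and Kuperberg introduced these parabolic slices for cylinders of
    infinite length.

    It remains to count the points of the axes within 2 rho of a given end.
    Unit discs normal to the axes at these points fill disjoint sets in the ball
    of radius 2 rho + 1 around the end, so these points have total length at
    most t0 (near_end_length). With n cylinders there are 2 n ends, and the
    cells have total volume at least n times

      2 sqrt 3 (t - 2 t0) + 2 pi t0 + 4 pi / 3,

    while each capped cylinder has volume pi (t + 4 / 3); the quotient is the
    bound. *)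

Set Implicit Arguments.
Unset Strict Implicit.
Unset Printing Implicit Defensive.

(** * Measure-preserving maps *)

Section measure_preserving.
Context {d : measure_display} {T : measurableType d} {R : realType}.
Variable m : set T -> \bar R.

Definition mpreserving (f : T -> T) :=
  measurable_fun setT f /\ forall A, measurable A -> m (f @^-1` A) = m A.

Lemma mpreserving_comp f g :
  mpreserving f -> mpreserving g -> mpreserving (f \o g).
Proof.
move=> [mf pf] [mg pg]; split; first exact: measurableT_comp.
move=> A mA; rewrite comp_preimage pg ?pf//.
by rewrite -[X in measurable X]setTI; exact: mf.
Qed.

End measure_preserving.

Section shears.
Context {d1 d2 : measure_display} {T1 : measurableType d1}
  {T2 : measurableType d2} {R : realType}.
Variables (m1 : {sigma_finite_measure set T1 -> \bar R})
          (m2 : {sigma_finite_measure set T2 -> \bar R}).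

Lemma product_measure_ysection (A : set (T1 * T2)) : measurable A ->
  ((m1 \x m2) A = \int[m2]_y m1 (ysection A y))%E.
Proof.
move=> mA; transitivity ((m1 \x^ m2)%E A) => //.
apply: product_measure_unique => // B C mB mC.
exact: product_measure2E.
Qed.

(** The measure of a set is the integral of the measures of its fibres, so a
    map that only moves points inside the fibres of a product preserves the
    product measure as soon as it preserves the measure of each fibre. *)
Lemma mpreserving_fiber2 (f : T1 -> T2 -> T2) :
  measurable_fun setT (fun p : T1 * T2 => (p.1, f p.1 p.2)) ->
  (forall x, mpreserving m2 (f x)) ->
  mpreserving (m1 \x m2)%E (fun p => (p.1, f p.1 p.2)).
Proof.
move=> mf pf; split => // A mA.
rewrite /product_measure1; apply: eq_integral => x _ /=.
rewrite -((pf x).2 (xsection A x)); last exact: measurable_xsection.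
by congr (m2 _); apply/seteqP; split => y /=; rewrite /xsection/= !inE.
Qed.

Lemma mpreserving_fiber1 (f : T2 -> T1 -> T1) :
  measurable_fun setT (fun p : T1 * T2 => (f p.2 p.1, p.2)) ->
  (forall y, mpreserving m1 (f y)) ->
  mpreserving (m1 \x m2)%E (fun p => (f p.2 p.1, p.2)).
Proof.
move=> mf pf; split => // A mA.
rewrite !product_measure_ysection//; last first.
  by rewrite -[X in measurable X]setTI; exact: mf.
apply: eq_integral => y _ /=.
rewrite -((pf y).2 (ysection A y)); last exact: measurable_ysection.
by congr (m1 _); apply/seteqP; split => x /=; rewrite /ysection/= !inE.
Qed.

End shears.

Section area.
Context {R : realType}.
Notation T1 := (measurableTypeR R).
Notation leb := (@lebesgue_measure R).

Definition area : set (T1 * T1)%type -> \bar R := (leb \x leb)%E.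

HB.instance Definition _ := Measure.on area.

Let sigma_finite_area : sigma_finite setT area.
Proof.
have /sigma_finiteP[F [TF ndF Foo]] := sigma_finiteT leb.
exists (fun n => F n `*` F n).
  rewrite -setXTT TF predeqE => -[x y]; split => [[/= [n _ Fx] [k _ Fy]]|].
    exists (maxn n k) => //; split => /=.
      by move: x Fx; exact/subsetPset/ndF/leq_maxl.
    by move: y Fy; exact/subsetPset/ndF/leq_maxr.
  by move=> [n _ []/= ? ?]; split; exists n.
move=> k; have [mk fk] := Foo k; split; first exact: measurableX.
by rewrite /area product_measure1E// lte_mul_pinfty// ge0_fin_numE.
Qed.

HB.instance Definition _ :=
  Measure_isSigmaFinite.Build _ _ _ area sigma_finite_area.

Definition vol3 : set (T1 * T1 * T1)%type -> \bar R := (area \x leb)%E.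

HB.instance Definition _ := Measure.on vol3.

End area.

(** * Rotations of the plane and motions of space *)

Section Lebesgue.
Context {R : realType}.
Notation T1 := (measurableTypeR R).
Notation leb := (@lebesgue_measure R).
Lemma mpreserving_translate (c : R) :
  mpreserving leb ((fun x : R => x + c) : T1 -> T1).
Proof.
have mc : measurable_fun setT ((fun x : R => x + c) : T1 -> T1).
  by apply: measurable_funD.
split => // A mA.
pose f : T1 -> T1 := (fun x : R => x + c).
apply/esym.
apply: (@lebesgue_measure_unique R (pushforward leb f)) => // _ [[a b]] _ <-.
transitivity (leb `]a - c, b - c]%classic); last first.
  congr (leb _); apply/seteqP; split => x /=; rewrite !in_itv/= /f;
  move=> /andP[? ?]; lra.
rewrite /= !lebesgue_measure_itv/= !lte_fin ltrD2r; case: ifP => //.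
by rewrite -!EFinB => _; congr EFin; lra.
Qed.

Lemma mpreserving_translate2 (a b : R) :
  mpreserving (@area R) (fun p : T1 * T1 => ((p.1 : R) + a, (p.2 : R) + b)).
Proof.
have h1 : mpreserving (@area R) (fun p : T1 * T1 => (p.1, (p.2 : R) + b)).
  apply: (@mpreserving_fiber2 _ _ _ _ _ leb leb (fun x => (fun y : R => y + b) : T1 -> T1)).
    by apply: measurable_fun_pair => //; apply: measurable_funD.
  by move=> _; exact: mpreserving_translate.
have h2 : mpreserving (@area R) (fun p : T1 * T1 => ((p.1 : R) + a, p.2)).
  apply: (@mpreserving_fiber1 _ _ _ _ _ leb leb (fun y => (fun x : R => x + a) : T1 -> T1)).
    by apply: measurable_fun_pair => //; apply: measurable_funD.
  by move=> _; exact: mpreserving_translate.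
exact: mpreserving_comp h1 h2.
Qed.

Lemma mpreserving_shear1 (k : R) :
  mpreserving (@area R) (fun p : T1 * T1 => ((p.1 : R) + k * p.2, p.2)).
Proof.
apply: (@mpreserving_fiber1 _ _ _ _ _ leb leb (fun y => (fun x : R => x + k * y) : T1 -> T1)).
  apply: measurable_fun_pair => //; apply: measurable_funD => //.
  exact: measurable_funM.
by move=> y; exact: mpreserving_translate.
Qed.

Lemma mpreserving_shear2 (k : R) :
  mpreserving (@area R) (fun p : T1 * T1 => (p.1, (p.2 : R) + k * p.1)).
Proof.
apply: (@mpreserving_fiber2 _ _ _ _ _ leb leb (fun x => (fun y : R => y + k * x) : T1 -> T1)).
  apply: measurable_fun_pair => //; apply: measurable_funD => //.
  exact: measurable_funM.
by move=> y; exact: mpreserving_translate.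
Qed.

(** A rotation of angle a is the product of three shears, of slopes
    - tan (a / 2), sin a and - tan (a / 2); the half turn, for which the
    tangent is infinite, is the square of a quarter turn. The functor lift
    lets the plane be a coordinate plane of a larger space. *)
Lemma mpreserving_lift_rotation d (T : measurableType d) (m : set T -> \bar R)
    (lift : (R * R -> R * R) -> T -> T) :
    (forall F G, lift (F \o G) = lift F \o lift G) ->
    (forall k, mpreserving m (lift (fun p => (p.1 + k * p.2, p.2)))) ->
    (forall k, mpreserving m (lift (fun p => (p.1, p.2 + k * p.1)))) ->
  forall c s, c ^+ 2 + s ^+ 2 = 1 ->
  mpreserving m (lift (fun p => (c * p.1 - s * p.2, s * p.1 + c * p.2))).
Proof.
move=> liftM sh1 sh2 c s.
wlog cN1 : c s / c != -1 => [hw|] cs.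
  have [cN1|] := boolP (c != -1); first exact: hw.
  rewrite negbK => /eqP cE.
  have s0 : s = 0.
    by apply/eqP; rewrite -sqrf_eq0; apply/eqP; move: cs; rewrite cE; lra.
  have h : mpreserving m
      (lift (fun p => (0 * p.1 - 1 * p.2, 1 * p.1 + 0 * p.2))).
    by apply: hw; lra.
  have := mpreserving_comp h h; rewrite -liftM.
  congr (mpreserving _ (lift _)); apply/funext => -[x y] /=.
  by rewrite cE s0; congr pair; lra.
have c1 : 1 + c != 0 by apply: contra cN1 => /eqP h; apply/eqP; lra.
have := mpreserving_comp (mpreserving_comp (sh1 (- (s / (1 + c)))) (sh2 s))
  (sh1 (- (s / (1 + c)))).
rewrite -!liftM.
congr (mpreserving _ (lift _)); apply/funext => -[x y] /=.
have st : s * (s / (1 + c)) = 1 - c.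
  have e : s * s = (1 - c) * (1 + c) by lra.
  by rewrite mulrA e mulfK.
set t := s / (1 + c) in st *.
have tc : t * c = s - t by rewrite /t; field.
congr pair.
  transitivity (x * (1 - s * t) - y * (2 * t - t * (s * t))); first by ring.
  rewrite st; transitivity (c * x - (t + t * c) * y); first by ring.
  by rewrite tc; ring.
transitivity (s * x + y * (1 - s * t)); first by ring.
by rewrite st; ring.
Qed.

Lemma mpreserving_rotation (c s : R) : c ^+ 2 + s ^+ 2 = 1 ->
  mpreserving (@area R) (fun p : T1 * T1 =>
    (c * (p.1 : R) - s * (p.2 : R), s * (p.1 : R) + c * (p.2 : R))).
Proof.
apply: (mpreserving_lift_rotation (T := (T1 * T1)%type) (lift := id)) => //.
  exact: mpreserving_shear1.
exact: mpreserving_shear2.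
Qed.

Let space := (T1 * T1 * T1)%type.

Lemma mpreserving_rotation12 (c s : R) : c ^+ 2 + s ^+ 2 = 1 ->
  mpreserving (@vol3 R) (fun p : space => (c * (p.1.1 : R) - s * (p.1.2 : R),
                              s * (p.1.1 : R) + c * (p.1.2 : R), p.2)).
Proof.
move=> cs; have [mr pr] := mpreserving_rotation cs.
apply: (@mpreserving_fiber1 _ _ _ _ _ (@area R) leb (fun z q =>
  (c * (q.1 : R) - s * (q.2 : R), s * (q.1 : R) + c * (q.2 : R)))).
  by apply: measurable_fun_pair => //; exact: (measurableT_comp mr).
by move=> _; exact: mpreserving_rotation.
Qed.

Lemma mpreserving_rotation13 (c s : R) : c ^+ 2 + s ^+ 2 = 1 ->
  mpreserving (@vol3 R) (fun p : space => (c * (p.1.1 : R) - s * (p.2 : R), p.1.2,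
                              s * (p.1.1 : R) + c * (p.2 : R))).
Proof.
apply: (mpreserving_lift_rotation (T := space)
    (lift := fun F p => ((F (p.1.1, p.2)).1, p.1.2, (F (p.1.1, p.2)).2))) => //.
- by move=> F G; apply/funext => -[[x y] z] /=; case: (G _).
- move=> k; apply: (@mpreserving_fiber1 _ _ _ _ _ (@area R) leb (fun z q =>
    ((q.1 : R) + k * (z : R), q.2))).
    apply: measurable_fun_pair => //=; apply: measurable_fun_pair => //=.
      apply: measurable_funD => //; last exact: measurable_funM.
      exact: measurableT_comp.
    exact: measurableT_comp.
  move=> z; have := mpreserving_translate2 (k * z) 0.
  by congr mpreserving; apply/funext => -[x y] /=; rewrite addr0.
- move=> k; have := (@mpreserving_fiber2 _ _ _ _ _ (@area R) leb (fun q z =>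
    (z : R) + k * (q.1 : R)) ).
  have -> : (fun p : space => (p.1.1, p.1.2, p.2 + k * p.1.1)) =
    (fun p => (p.1, (p.2 : R) + k * (p.1.1 : R))).
    by apply/funext => -[[x y] z].
  apply.
    apply: measurable_fun_pair => //; apply: measurable_funD => //.
    by apply: measurable_funM => //; exact: measurableT_comp.
  by move=> x; exact: mpreserving_translate.
Qed.

Lemma mpreserving_translate3 (a b c : R) :
  mpreserving (@vol3 R) (fun p : space =>
    ((p.1.1 : R) + a, (p.1.2 : R) + b, (p.2 : R) + c)).
Proof.
have h1 : mpreserving (@vol3 R) (fun p : space => (p.1, (p.2 : R) + c)).
  apply: (@mpreserving_fiber2 _ _ _ _ _ (@area R) leb (fun q => (fun y : R => y + c) : T1 -> T1)).
    by apply: measurable_fun_pair => //; apply: measurable_funD.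
  by move=> _; exact: mpreserving_translate.
have [mt pt] := mpreserving_translate2 a b.
have h2 : mpreserving (@vol3 R) (fun p : space =>
    ((p.1.1 : R) + a, (p.1.2 : R) + b, p.2)).
  apply: (@mpreserving_fiber1 _ _ _ _ _ (@area R) leb (fun z q =>
     ((q.1 : R) + a, (q.2 : R) + b))).
    by apply: measurable_fun_pair => //; exact: (measurableT_comp mt).
  by move=> _; exact: mpreserving_translate2.
exact: mpreserving_comp h1 h2.
Qed.

End Lebesgue.

Section frame.
Context {R : realType}.
Notation T1 := (measurableTypeR R).
Notation leb := (@lebesgue_measure R).
Implicit Types x y v : 'rV[R]_3.

Definition dot x y : R := \sum_(i < 3) x ord0 i * y ord0 i.

Lemma dotE x y : dot x y =
  x ord0 ord0 * y ord0 ord0 + x ord0 1 * y ord0 1 + x ord0 2%R * y ord0 2%R.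
Proof.
rewrite /dot !big_ord_recr big_ord0 /= add0r.
have -> : widen_ord (leqnSn 2) (widen_ord (leqnSn 1) ord_max) = ord0 :> 'I_3 by exact: val_inj.
have -> : widen_ord (leqnSn 2) ord_max = 1 :> 'I_3 by exact: val_inj.
by have -> : ord_max = 2%R :> 'I_3 by exact: val_inj.
Qed.

Lemma dotC x y : dot x y = dot y x.
Proof. by rewrite !dotE; ring. Qed.

Lemma dotDl x y v : dot (x + y) v = dot x v + dot y v.
Proof. by rewrite !dotE !mxE; ring. Qed.

Lemma dotZl k x y : dot (k *: x) y = k * dot x y.
Proof. by rewrite !dotE !mxE; ring. Qed.

Lemma dotNl x y : dot (- x) y = - dot x y.
Proof. by rewrite !dotE !mxE; ring. Qed.

Lemma dotDr x y v : dot v (x + y) = dot v x + dot v y.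
Proof. by rewrite dotC dotDl !(dotC v). Qed.

Lemma dotZr k x y : dot x (k *: y) = k * dot x y.
Proof. by rewrite dotC dotZl dotC. Qed.

Lemma dotNr x y : dot x (- y) = - dot x y.
Proof. by rewrite dotC dotNl dotC. Qed.

Definition linE := (dotDl, dotDr, dotZl, dotZr, dotNl, dotNr).

Lemma dot_ge0 x : 0 <= dot x x.
Proof. by apply: sumr_ge0 => i _; rewrite -expr2 sqr_ge0. Qed.

(** A Euclidean motion carries the vertical axis to any given line; the area
    of a normal slice can therefore be computed on horizontal planes. *)
Lemma exists_frame (a v : 'rV[R]_3) : dot v v = 1 -> exists f1 f2 : 'rV[R]_3,
  [/\ dot f1 f1 = 1, dot f2 f2 = 1, dot f1 f2 = 0 & dot f1 v = 0 /\ dot f2 v = 0]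
  /\ exists2 G : T1 * T1 * T1 -> T1 * T1 * T1, mpreserving (@vol3 R) G &
     forall x y z : R,
       vec3 (G (x, y, z)) = a + x *: f1 + y *: f2 + z *: v.
Proof.
move=> vv.
set v0 := v ord0 ord0; set v1 := v ord0 1; set v2 := v ord0 2%R.
have v1E : v0 * v0 + v1 * v1 + v2 * v2 = 1 by rewrite -vv dotE.
pose s := Num.sqrt (v0 ^+ 2 + v1 ^+ 2).
have s2 : s ^+ 2 = v0 ^+ 2 + v1 ^+ 2 by rewrite sqr_sqrtr// addr_ge0 ?sqr_ge0.
have [c1 [c2 [cc e0 e1]]] : exists c1 c2,
    [/\ c1 ^+ 2 + c2 ^+ 2 = 1, c1 * s = v0 & c2 * s = v1].
  have [s0|s0] := eqVneq s 0.
    exists 1, 0; move: s2; rewrite s0 expr0n /= => /esym/eqP.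
    rewrite paddr_eq0 ?sqr_ge0// !sqrf_eq0 => /andP[/eqP -> /eqP ->].
    by split; ring.
  exists (v0 / s), (v1 / s); rewrite !divfK//; split => //.
  by rewrite !expr_div_n -mulrDl -s2 mulfV// sqrf_eq0.
have sv2 : v2 ^+ 2 + (- s) ^+ 2 = 1 by rewrite sqrrN s2; lra.
pose f1 := vec3 (c1 * v2, c2 * v2, - s).
pose f2 := vec3 (- c2, c1, 0).
have vE : v = vec3 (c1 * s, c2 * s, v2).
  apply/rowP => i; rewrite !mxE e0 e1.
  case: i => -[|[|[|//]]] i3 /=; rewrite /v0 /v1 /v2;
  by congr (v _ _); exact: val_inj.
exists f1, f2; split.
  have cc' : c1 * c1 + c2 * c2 = 1 by rewrite -!expr2.
  have sv' : v2 * v2 + s * s = 1 by rewrite -sv2; ring.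
  rewrite vE /f1 /f2 !dotE !mxE /=; split.
  - transitivity ((c1 * c1 + c2 * c2) * (v2 * v2) + s * s); first by ring.
    by rewrite cc' mul1r.
  - by rewrite -cc'; ring.
  - by ring.
  - split; last by ring.
    transitivity ((c1 * c1 + c2 * c2) * (v2 * s) - v2 * s); first by ring.
    by rewrite cc'; ring.
exists ((fun p => ((p.1.1 : R) + a ord0 ord0, (p.1.2 : R) + a ord0 1, (p.2 : R) + a ord0 2%R))
  \o ((fun p => (c1 * (p.1.1 : R) - c2 * (p.1.2 : R),
                              c2 * (p.1.1 : R) + c1 * (p.1.2 : R), p.2))
  \o (fun p => (v2 * (p.1.1 : R) - (- s) * (p.2 : R), p.1.2,
                              (- s) * (p.1.1 : R) + v2 * (p.2 : R))))).
  apply: mpreserving_comp; first exact: mpreserving_translate3.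
  apply: mpreserving_comp; first exact: mpreserving_rotation12.
  exact: mpreserving_rotation13.
move=> x y z; rewrite [in RHS]vE; apply/rowP => i; rewrite !mxE /=.
case: i => -[|[|[|//]]] i3 /=.
- rewrite (_ : Ordinal i3 = ord0); last exact: val_inj.
  by ring.
- rewrite (_ : Ordinal i3 = 1); last exact: val_inj.
  by ring.
- rewrite (_ : Ordinal i3 = 2%R); last exact: val_inj.
  by ring.
Qed.

End frame.


(** * Areas and volumes by slicing *)

Section slices.
Context {R : realType}.
Notation T1 := (measurableTypeR R).
Notation leb := (@lebesgue_measure R).

Lemma measurable_set_lt d (T : measurableType d) (f g : T -> R) :
  measurable_fun setT f -> measurable_fun setT g ->
  measurable [set x | f x < g x].
Proof.
move=> mf mg; have := measurable_fun_ltr mf mg measurableT.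
by move=> /(_ [set true]); rewrite setTI; apply.
Qed.

Lemma measurable_set_le d (T : measurableType d) (f g : T -> R) :
  measurable_fun setT f -> measurable_fun setT g ->
  measurable [set x | f x <= g x].
Proof.
move=> mf mg; have := measurable_fun_ler mf mg measurableT.
by move=> /(_ [set true]); rewrite setTI; apply.
Qed.

Lemma area_slices (A : set (T1 * T1)) : measurable A ->
  (area A = \int[leb]_x leb [set y | A (x, y)])%E.
Proof.
move=> mA; rewrite /area /product_measure1; apply: eq_integral => x _ /=.
by congr (leb _); apply/seteqP; split => y /=; rewrite /xsection/= !inE.
Qed.

Lemma measurable_slice_length (A : set (T1 * T1)) : measurable A ->
  measurable_fun setT (fun x : T1 => leb [set y | A (x, y)]).
Proof.
move=> mA; have := measurable_fun_xsection leb mA.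
congr measurable_fun; apply/funext => x /=.
by congr (leb _); apply/seteqP; split => y /=; rewrite /xsection/= !inE.
Qed.

Lemma vol3_slices (A : set (T1 * T1 * T1)) : measurable A ->
  (vol3 A = \int[leb]_z area [set q | A (q, z)])%E.
Proof.
move=> mA; transitivity (\int[leb]_y area (ysection A y))%E.
  exact: product_measure_ysection.
apply: eq_integral => z _.
by congr (area _); apply/seteqP; split => y /=; rewrite /ysection/= !inE.
Qed.

Lemma measurable_slice_area (A : set (T1 * T1 * T1)) : measurable A ->
  measurable_fun setT (fun z : T1 => area [set q | A (q, z)]).
Proof.
move=> mA; have := measurable_fun_ysection (@area R) mA.
congr measurable_fun; apply/funext => x /=.
by congr (area _); apply/seteqP; split => y /=; rewrite /ysection/= !inE.
Qed.

Lemma integral_primitive (f F : R -> R) (a b : R) : a < b ->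
    {within `[a, b], continuous f} -> {within `[a, b], continuous F} ->
    (forall x, a < x < b -> is_derive x 1 F (f x)) ->
  measurable_fun (`]a, b[ : set T1) (EFin \o f) /\
  (\int[leb]_(x in `]a, b[) (f x)%:E = (F b - F a)%:E)%E.
Proof.
move=> ab cf cF dF.
have dFo : derivable_oo_LRcontinuous F a b.
  have [_ cFa cFb] := (continuous_within_itvP F ab).1 cF; split => //.
  by move=> x; rewrite in_itv /= => /dF [].
have dFE : {in `]a, b[, derive1 F =1 f}.
  by move=> x; rewrite in_itv /= => /dF [_ <-]; rewrite derive1E.
have mf : measurable_fun (`]a, b[ : set T1) (EFin \o f).
  apply/measurable_EFinP.
  have mf : measurable_fun (`[a, b] : set R) f.
    exact: subspace_continuous_measurable_fun.
  by apply: measurable_funS mf => //; exact: subset_itv_oo_cc.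
split => //; rewrite EFinB -(continuous_FTC2 ab cf dFo dFE).
exact/esym/integral_itv_bndoo.
Qed.

Lemma integral_ge_primitive (g : T1 -> \bar R) (f F : R -> R) (a b : R) :
    a < b -> measurable_fun setT g -> (forall x, (0 <= g x)%E) ->
    {within `[a, b], continuous f} -> {within `[a, b], continuous F} ->
    (forall x, a < x < b -> is_derive x 1 F (f x)) ->
    (forall x, a < x < b -> 0 <= f x) ->
    (forall x, a < x < b -> ((f x)%:E <= g x)%E) ->
  ((F b - F a)%:E <= \int[leb]_x g x)%E.
Proof.
move=> ab mg g0 cf cF dF f0 fg.
have [mf <-] := integral_primitive ab cf cF dF.
apply: (@le_trans _ _ (\int[leb]_(x in `]a, b[) g x)%E).
  apply: ge0_le_integral => //.
  by apply: measurable_funTS.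
exact: ge0_subset_integral.
Qed.

Lemma integral_le_primitive (g : T1 -> \bar R) (f F : R -> R) (a b : R) :
    a < b -> measurable_fun setT g -> (forall x, (0 <= g x)%E) ->
    {within `[a, b], continuous f} -> {within `[a, b], continuous F} ->
    (forall x, a < x < b -> is_derive x 1 F (f x)) ->
    (forall x, ~~ (a <= x <= b) -> g x = 0%E) ->
    (forall x, a < x < b -> (g x <= (f x)%:E)%E) ->
  (\int[leb]_x g x <= (F b - F a)%:E)%E.
Proof.
move=> ab mg g0 cf cF dF gz fg.
have [mf <-] := integral_primitive ab cf cF dF.
apply: (@le_trans _ _ (\int[leb]_(x in `]a, b[) g x)%E); last first.
  by apply: ge0_le_integral => //; apply: measurable_funTS.
rewrite -(@integral_itv_bndoo R a b g true false); last exact: measurable_funTS.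
rewrite [leRHS]integral_mkcond le_eqVlt; apply/orP; left; apply/eqP.
apply: eq_integral => x _; rewrite patchE; case: ifPn => // xab.
by rewrite gz//; apply: contra xab => xab; rewrite inE/= in_itv.
Qed.

End slices.

(** * Discs, balls and capsules *)

Section disc.
Context {R : realType}.
Notation T1 := (measurableTypeR R).
Notation leb := (@lebesgue_measure R).
Implicit Types r x y : R.

(** Continuity up to the end points, where acos has no derivative: the
    fundamental theorem of calculus needs it for the area of a whole disc. *)
Lemma within_continuous_acos : {within `[(- 1 : R), 1], continuous (@acos R)}.
Proof.
have := @segment_can_ge_continuous R 0 pi cos acos (pi_ge0 R).
rewrite cos0 cospi; apply.
  by apply: continuous_subspaceT => x; exact: continuous_cos.
by move=> x xpi; rewrite cosK.
Qed.

Definition halfchord r x := Num.sqrt (r ^+ 2 - x ^+ 2).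

(** A primitive of twice the half chord; up to sign and a constant, the area
    of the circular segment beyond the abscissa x. *)
Definition circle_primitive r x := x * halfchord r x - r ^+ 2 * acos (x / r).

Lemma continuous_halfchord r : continuous (halfchord r).
Proof.
move=> x; apply: (@continuous_comp _ _ _ (fun y => r ^+ 2 - y ^+ 2) Num.sqrt).
  apply: continuousB; first exact: cvg_cst.
  exact: exprn_continuous.
exact: sqrt_continuous.
Qed.

Lemma within_continuous_circle_primitive r a b : 0 < r -> - r <= a -> b <= r ->
  {within `[a, b], continuous (circle_primitive r)}.
Proof.
move=> r0 ra br; apply/subspace_continuousP => x xab.
apply: cvgB.
  apply: cvgM; first exact: cvg_within_filter.
  apply: cvg_within_filter; exact: continuous_halfchord.
apply: cvgM; first exact: cvg_cst.
have /subspace_continuousP h := within_continuous_acos.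
have mem y : `[a, b]%classic y -> `[(- 1), 1]%classic (y / r).
  rewrite /= !in_itv/= => /andP[ay yb].
  by rewrite ler_pdivlMr// ler_pdivrMr// mulN1r mul1r; apply/andP; split; lra.
have hc : (fun y => y / r) y @[y --> within `[a, b] (nbhs x)] -->
    within `[(- 1), 1] (nbhs (x / r)).
  move=> A hA.
  have c : {for x, continuous (fun y => y / r)} by exact: mulrr_continuous.
  have hA' : \forall y \near x, `[(- 1), 1]%classic (y / r) -> A (y / r).
    exact: c _ hA.
  have : \forall y \near x, `[a, b]%classic y -> A (y / r).
    by near=> y => yab; have /(_ (mem _ yab)) : `[(- 1), 1]%classic (y / r) -> A (y / r) by near: y.
  exact.
exact: (cvg_comp _ _ hc (h (x / r) (mem _ xab))).
Unshelve. all: by end_near. Qed.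

Lemma is_derive_circle_primitive r x : 0 < r -> - r < x < r ->
  is_derive x 1 (circle_primitive r) (2 * halfchord r x).
Proof.
move=> r0 /andP[rx xr].
have p0 : 0 < r ^+ 2 - x ^+ 2 by nra.
have S0 : 0 < halfchord r x by rewrite sqrtr_gt0.
have SS : halfchord r x ^+ 2 = r ^+ 2 - x ^+ 2 by rewrite sqr_sqrtr// ltW.
have xr1 : -1 < x / r < 1.
  by rewrite ltr_pdivlMr// ltr_pdivrMr// mulN1r mul1r; apply/andP.
have E1 : Num.sqrt (1 - (x / r) ^+ 2) = halfchord r x / r.
  have -> : 1 - (x / r) ^+ 2 = (halfchord r x / r) ^+ 2.
    by rewrite !expr_div_n SS; field; rewrite gt_eqF.
  by rewrite sqrtr_sqr ger0_norm// divr_ge0// ltW.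
have D1 : is_derive x 1 (halfchord r) (- x / halfchord r x).
  have d1 : is_derive x 1 (fun y : R => r ^+ 2 - y ^+ 2) (- (2 * x)).
    by apply: is_derive_eq; rewrite /GRing.scale /=; ring.
  have d2 := is_derive1_sqrt p0.
  have := @is_derive1_comp R Num.sqrt (fun y : R => r ^+ 2 - y ^+ 2) x _ _ d2 d1.
  move/is_derive_eq; apply; rewrite -/(halfchord r x) /GRing.scale /=.
  by field; rewrite gt_eqF.
have D2 : is_derive x 1 (fun y => acos (y / r)) (- (halfchord r x)^-1).
  have d1 : is_derive x 1 (fun y : R => y / r) r^-1.
    by apply: is_derive_eq; rewrite /GRing.scale /=; ring.
  have d2 := is_derive1_acos xr1.
  have := @is_derive1_comp R acos (fun y : R => y / r) x _ _ d2 d1.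
  move/is_derive_eq; apply; rewrite E1 /GRing.scale /=.
  by field; rewrite !gt_eqF.
apply: (@is_derive_eq _ _ _ (fun y => y * halfchord r y - r ^+ 2 * acos (y / r))).
rewrite /GRing.scale /=.
apply: (mulIf (negbT (gt_eqF S0))).
transitivity (2 * halfchord r x ^+ 2); last by ring.
transitivity (halfchord r x ^+ 2 + r ^+ 2 - x ^+ 2); last by lra.
by field; rewrite gt_eqF.
Qed.

End disc.


Section discs.
Context {R : realType}.
Notation T1 := (measurableTypeR R).
Notation leb := (@lebesgue_measure R).
Implicit Types r x y : R.

Lemma leb_sqr_lt (c : R) :
  leb [set y : R | y ^+ 2 < c] = (2 * Num.sqrt c)%:E.
Proof.
have [c0|c0] := leP c 0.
  rewrite ler0_sqrtr// mulr0.
  rewrite (_ : [set y | _] = set0) ?measure0//.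
  by apply/seteqP; split => y //= yc; have := sqr_ge0 y; lra.
rewrite (_ : [set y | _] = `]- Num.sqrt c, Num.sqrt c[%classic); last first.
  apply/seteqP; split => y /=; rewrite in_itv/= -ltr_norml -sqrtr_sqr ltr_sqrt//.
have s0 : 0 < Num.sqrt c by rewrite sqrtr_gt0.
rewrite /= lebesgue_measure_itv/= lte_fin ifT; last by lra.
by rewrite -EFinB; congr EFin; lra.
Qed.

Lemma leb_sqr_le (c : R) :
  leb [set y : R | y ^+ 2 <= c] = (2 * Num.sqrt c)%:E.
Proof.
have [c0|c0] := ltP c 0.
  rewrite ler0_sqrtr ?ltW// mulr0.
  rewrite (_ : [set y | _] = set0) ?measure0//.
  by apply/seteqP; split => y //= yc; have := sqr_ge0 y; lra.
have s0 : 0 <= Num.sqrt c by exact: sqrtr_ge0.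
rewrite (_ : [set y | _] = `[- Num.sqrt c, Num.sqrt c]%classic); last first.
  by apply/seteqP; split => y /=; rewrite in_itv/= -ler_norml -sqrtr_sqr ler_sqrt.
rewrite /= lebesgue_measure_itv/= lte_fin; case: ifPn.
  by rewrite -EFinB => _; congr EFin; lra.
by rewrite -leNgt => h; congr EFin; lra.
Qed.

Lemma integral_halfchord r : 0 < r ->
  (\int[leb]_x (2 * halfchord r x)%:E = (pi * r ^+ 2)%:E)%E.
Proof.
move=> r0.
have rr : - r < r by lra.
have cE : circle_primitive r r - circle_primitive r (- r) = pi * r ^+ 2.
  rewrite /circle_primitive /halfchord sqrrN subrr sqrtr0 !mulr0 mulNr divff ?gt_eqF//.
  by rewrite acos1 acosN1; ring.
have mg : measurable_fun setT (fun x : T1 => (2 * halfchord r x)%:E).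
  apply/measurable_EFinP; apply: measurable_funM => //.
  apply: continuous_measurable_fun; exact: continuous_halfchord.
have g0 x : (0 <= (2 * halfchord r x)%:E)%E by rewrite lee_fin mulr_ge0// sqrtr_ge0.
have cf : {within `[- r, r], continuous (fun x => 2 * halfchord r x)}.
  apply: continuous_subspaceT => x.
  by apply: cvgM; [exact: cvg_cst|exact: continuous_halfchord].
have cF := @within_continuous_circle_primitive R r (- r) r r0 (lexx _) (lexx _).
have dF x : - r < x < r -> is_derive x 1 (circle_primitive r) (2 * halfchord r x).
  exact: is_derive_circle_primitive.
apply/eqP; rewrite eq_le -cE; apply/andP; split.
  apply: (integral_le_primitive rr mg g0 cf cF dF) => // x.
  rewrite -ler_norml -ltNge => h; congr EFin.
  rewrite /halfchord ler0_sqrtr ?mulr0// subr_le0.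
  by rewrite -(real_normK (num_real x)) ler_sqr ?nnegrE ?(ltW r0)// ltW.
apply: (integral_ge_primitive rr mg g0 cf cF dF) => // x _.
by rewrite mulr_ge0// sqrtr_ge0.
Qed.

Lemma measurable_sqdist2 :
  measurable_fun setT (fun q : T1 * T1 => (q.1 : R) ^+ 2 + (q.2 : R) ^+ 2).
Proof. by apply: measurable_funD; apply: measurable_funX. Qed.

Lemma area_disc_lt (c : R) :
  area [set q : T1 * T1 | (q.1 : R) ^+ 2 + (q.2 : R) ^+ 2 < c] =
  (pi * Num.max 0 c)%:E.
Proof.
have [c0|c0] := leP c 0.
  rewrite mulr0 (_ : [set q | _] = set0) ?measure0//.
  apply/seteqP; split => q //= yc.
  by have := sqr_ge0 (q.1 : R); have := sqr_ge0 (q.2 : R); lra.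
rewrite area_slices; last exact: (measurable_set_lt measurable_sqdist2).
rewrite -(sqr_sqrtr (ltW c0)) -integral_halfchord ?sqrtr_gt0//.
apply: eq_integral => x _; rewrite /halfchord -leb_sqr_lt.
by congr (leb _); apply/seteqP; split => y /=; lra.
Qed.

Lemma area_disc_le (c : R) :
  area [set q : T1 * T1 | (q.1 : R) ^+ 2 + (q.2 : R) ^+ 2 <= c] =
  (pi * Num.max 0 c)%:E.
Proof.
have [c0|c0] := ltP c 0.
  rewrite mulr0 (_ : [set q | _] = set0) ?measure0//.
  apply/seteqP; split => q //= yc.
  by have := sqr_ge0 (q.1 : R); have := sqr_ge0 (q.2 : R); lra.
rewrite area_slices; last exact: (measurable_set_le measurable_sqdist2).
have [->|cn0] := eqVneq c 0.
  rewrite mulr0; apply: integral0_eq => x _.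
  transitivity ((2 * Num.sqrt (0 - x ^+ 2))%:E).
    by rewrite -leb_sqr_le; congr (leb _); apply/seteqP; split => y /=; lra.
  by rewrite ler0_sqrtr ?mulr0// sub0r oppr_le0 sqr_ge0.
rewrite -(sqr_sqrtr c0) -integral_halfchord ?sqrtr_gt0 ?lt_neqAle 1?eq_sym ?cn0//.
apply: eq_integral => x _; rewrite /halfchord -leb_sqr_le.
by congr (leb _); apply/seteqP; split => y /=; lra.
Qed.

Lemma vol3_revolution_le (phi : R -> R) :
  measurable_fun setT (phi : T1 -> R) ->
  (vol3 [set p : T1 * T1 * T1 |
      ((p.1.1 : R) ^+ 2 + (p.1.2 : R) ^+ 2 <= phi p.2)%R] =
    \int[leb]_z (pi * Num.max 0 (phi z))%:E)%E.
Proof.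
move=> mphi; rewrite vol3_slices.
  by apply: eq_integral => z _; rewrite /= area_disc_le.
apply: measurable_set_le; last exact: measurableT_comp mphi _.
by have := measurableT_comp measurable_sqdist2 (@measurable_fst _ _ (T1 * T1)%type T1).
Qed.

End discs.


Section capsule.
Context {R : realType}.
Notation T1 := (measurableTypeR R).
Notation leb := (@lebesgue_measure R).
Implicit Types r x y : R.

Lemma is_derive_continuous (f : R -> R) x l : is_derive x 1 f l ->
  {for x, continuous f}.
Proof. by move=> [df _]; apply/differentiable_continuous/derivable1_diffP. Qed.

Lemma integral_smooth_primitive (F f f' : R -> R) (a b : R) : a <= b ->
    (forall x, is_derive x 1 F (f x)) -> (forall x, is_derive x 1 f (f' x)) ->
  (\int[leb]_(x in `]a, b[) (f x)%:E = (F b - F a)%:E)%E.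
Proof.
rewrite le_eqVlt => /predU1P[-> _ _|ab dF df].
  by rewrite set_itvoo0 integral_set0 subrr.
apply: (integral_primitive ab _ _ _).2 => //.
- by apply: continuous_subspaceT => x; exact: is_derive_continuous (df x).
- by apply: continuous_subspaceT => x; exact: is_derive_continuous (dF x).
Qed.

Lemma integral_oo_split (g : T1 -> \bar R) (a b c : R) :
  a <= b -> b <= c -> measurable_fun setT g -> (forall x, (0 <= g x)%E) ->
  (\int[leb]_(x in `]a, c[) g x =
   \int[leb]_(x in `]a, b[) g x + \int[leb]_(x in `]b, c[) g x)%E.
Proof.
rewrite le_eqVlt => /predU1P[-> _ _ _|ab].
  by rewrite set_itvoo0 integral_set0 add0e.
rewrite le_eqVlt => /predU1P[-> _ _|bc mg g0].
  by rewrite set_itvoo0 integral_set0 adde0.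
rewrite -(@integral_itv_bndoo R a b g false false); last exact: measurable_funTS.
rewrite (@itv_bndbnd_setU _ _ _ (BRight b)) ?bnd_simp//; last exact: ltW.
rewrite ge0_integral_setU//; first exact: measurable_funTS.
apply/disj_setPS => x [] /=; rewrite !in_itv/= => /andP[_ h1] /andP[h2 _].
by rewrite ltNge h1 in h2.
Qed.

Lemma integral_support_oo (g : T1 -> \bar R) (a b : R) :
    (forall x, ~~ (a < x < b) -> g x = 0%E) ->
  (\int[leb]_x g x = \int[leb]_(x in `]a, b[) g x)%E.
Proof.
move=> gz; rewrite [RHS]integral_mkcond; apply: eq_integral => x _.
rewrite patchE; case: ifPn => // xab.
by rewrite gz//; apply: contra xab => xab; rewrite inE/= in_itv.
Qed.

(** The height of the point nearest to height z on the vertical segment from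
    0 to t. *)
Definition clamp (t z : R) : R := Num.max 0 (Num.min z t).

Lemma measurable_clamp t : measurable_fun setT (clamp t : T1 -> R).
Proof. by apply: measurable_maxr => //; apply: measurable_minr. Qed.

(** The three pieces are a half ball, a cylinder and a half ball. *)
Lemma integral_capsule (t r : R) : 0 <= t -> 0 < r ->
  (\int[leb]_z (pi * Num.max 0 (r ^+ 2 - (z - clamp t z) ^+ 2))%:E =
   (pi * (r ^+ 2 * t + 4 / 3 * r ^+ 3))%:E)%E.
Proof.
move=> t0 r0; set g := fun z : R => _.
have mg : measurable_fun setT (g : T1 -> _).
  apply/measurable_EFinP; apply: measurable_funM => //.
  apply: measurable_maxr => //; apply: measurable_funB => //.
  apply: measurable_funX; apply: measurable_funB => //.
  exact: measurable_clamp.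
have g0 z : (0 <= g z)%E.
  by rewrite lee_fin mulr_ge0 ?pi_ge0// le_max lexx.
have clo z : z <= 0 -> clamp t z = 0.
  by move=> z0; rewrite /clamp min_l ?max_l//; lra.
have cmid z : 0 <= z <= t -> clamp t z = z.
  by move=> /andP[z0 zt]; rewrite /clamp min_l ?max_r//; lra.
have chi z : t <= z -> clamp t z = t.
  by move=> tz; rewrite /clamp min_r ?max_r//; lra.
rewrite (@integral_support_oo g (- r) (t + r)); last first.
  move=> z; rewrite negb_and -!leNgt => h; congr EFin.
  rewrite max_l ?mulr0//; case/orP: h => h.
    by rewrite clo; nra.
  by rewrite chi; nra.
rewrite (@integral_oo_split g (- r) 0)//; [|lra|lra].
rewrite (@integral_oo_split g 0 t)//; last by lra.
have i1 : (\int[leb]_(x in `](- r)%R, 0%R[) g x = (pi * (2 / 3 * r ^+ 3))%:E)%E.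
  transitivity (\int[leb]_(x in `](- r)%R, 0%R[) (pi * (r ^+ 2 - x ^+ 2))%R%:E)%E.
    apply: eq_integral => z; rewrite inE/= in_itv/= => /andP[z0 z1].
    by rewrite /g clo ?ltW// subr0 max_r//; nra.
  have dF (x : R) : is_derive x 1 (fun z : R => pi * (r ^+ 2 * z - z ^+ 3 / 3)) (pi * (r ^+ 2 - x ^+ 2)).
    by apply: is_derive_eq; rewrite /GRing.scale /=; field.
  have df (x : R) : is_derive x 1 (fun x : R => pi * (r ^+ 2 - x ^+ 2)) (pi * - (2 * x)).
    by apply: is_derive_eq; rewrite /GRing.scale /=; ring.
  apply: etrans (integral_smooth_primitive _ dF df) _; first by lra.
  by congr EFin; field.
have i2 : (\int[leb]_(x in `]0%R, t[) g x = (pi * (r ^+ 2 * t))%:E)%E.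
  transitivity (\int[leb]_(x in `]0%R, t[) (pi * r ^+ 2)%:E)%E.
    apply: eq_integral => z; rewrite inE/= in_itv/= => /andP[z0 z1].
    by rewrite /g cmid ?subrr ?expr0n ?subr0 ?max_r ?sqr_ge0// !ltW.
  have dF (x : R) : is_derive x 1 (fun z : R => pi * r ^+ 2 * z) (pi * r ^+ 2).
    by apply: is_derive_eq; rewrite /GRing.scale /=; field.
  have df (x : R) : is_derive x 1 (fun x : R => pi * r ^+ 2) (0).
    by apply: is_derive_eq; rewrite /GRing.scale /=; ring.
  apply: etrans (integral_smooth_primitive _ dF df) _; first by lra.
  by congr EFin; field.
have i3 : (\int[leb]_(x in `]t, (t + r)%R[) g x = (pi * (2 / 3 * r ^+ 3))%:E)%E.
  transitivity (\int[leb]_(x in `]t, (t + r)%R[) (pi * (r ^+ 2 - (x - t) ^+ 2))%R%:E)%E.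
    apply: eq_integral => z; rewrite inE/= in_itv/= => /andP[z0 z1].
    by rewrite /g chi ?ltW// max_r//; nra.
  have dF (x : R) : is_derive x 1 (fun z : R => pi * (r ^+ 2 * z - (z - t) ^+ 3 / 3)) (pi * (r ^+ 2 - (x - t) ^+ 2)).
    by apply: is_derive_eq; rewrite /GRing.scale /=; field.
  have df (x : R) : is_derive x 1 (fun x : R => pi * (r ^+ 2 - (x - t) ^+ 2)) (pi * - (2 * (x - t))).
    by apply: is_derive_eq; rewrite /GRing.scale /=; ring.
  apply: etrans (integral_smooth_primitive _ dF df) _; first by lra.
  by congr EFin; field.
by rewrite i1 i2 i3 -!EFinD; congr EFin; field.
Qed.

(** The closed neighbourhood of radius r of a vertical segment of length t; for
    t = 0, a ball. *)
Definition capsule_le (t r : R) : set (T1 * T1 * T1) := [set p |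
  (p.1.1 : R) ^+ 2 + (p.1.2 : R) ^+ 2 <= r ^+ 2 - ((p.2 : R) - clamp t p.2) ^+ 2].

Lemma measurable_capsule_profile t r :
  measurable_fun setT ((fun z : R => r ^+ 2 - (z - clamp t z) ^+ 2) : T1 -> R).
Proof.
apply: measurable_funB => //.
apply: measurable_funX; apply: measurable_funB => //.
exact: measurable_clamp.
Qed.

Lemma vol3_capsule_le (t r : R) : 0 <= t -> 0 < r ->
  vol3 (capsule_le t r) = (pi * (r ^+ 2 * t + 4 / 3 * r ^+ 3))%:E.
Proof.
move=> t0 r0; rewrite -integral_capsule//.
by apply: vol3_revolution_le; exact: measurable_capsule_profile.
Qed.

End capsule.


(** * The hexagonal density of a sector *)

Section scalar.
Context {R : realType}.
Implicit Types x s : R.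

Lemma sqr_sqrt3 : Num.sqrt 3 ^+ 2 = 3 :> R.
Proof. by rewrite sqr_sqrtr. Qed.

Lemma sqrt3_gt0 : 0 < Num.sqrt 3 :> R.
Proof. by rewrite sqrtr_gt0. Qed.

(** By the mean value theorem, a negative value of f at x would make f'
    negative before x and positive after x, hence f'' positive somewhere. *)
Lemma concave_ge0 (f f' f'' : R -> R) (a b x : R) :
    (forall x, is_derive x 1 f (f' x)) -> (forall x, is_derive x 1 f' (f'' x)) ->
    (forall x, a < x < b -> f'' x <= 0) -> 0 <= f a -> 0 <= f b ->
  a <= x <= b -> 0 <= f x.
Proof.
move=> df df' f''0 fa fb /andP[ax xb]; rewrite leNgt; apply/negP => fx0.
have cf (u v : R) : {within `[u, v], continuous f}.
  by apply: continuous_subspaceT => y; exact: is_derive_continuous (df y).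
have cf' (u v : R) : {within `[u, v], continuous f'}.
  by apply: continuous_subspaceT => y; exact: is_derive_continuous (df' y).
have {}ax : a < x.
  by rewrite lt_neqAle ax andbT; apply/eqP => axE; move: fa; rewrite axE; lra.
have {}xb : x < b.
  by rewrite lt_neqAle xb andbT; apply/eqP => axE; move: fb; rewrite -axE; lra.
have [c1] := MVT ax (fun y _ => df y) (cf _ _).
rewrite in_itv/= => /andP[ac1 c1x] e1.
have [c2] := MVT xb (fun y _ => df y) (cf _ _).
rewrite in_itv/= => /andP[xc2 c2b] e2.
have c12 : c1 < c2 by lra.
have [c3] := MVT c12 (fun y _ => df' y) (cf' _ _).
rewrite in_itv/= => /andP[c13 c32] e3.
have h1 : f' c1 < 0 by nra.
have h2 : 0 < f' c2 by nra.
have := f''0 c3; rewrite (lt_trans ac1 c13) (lt_trans c32 c2b) => /(_ isT).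
by nra.
Qed.

Lemma sin_pi6 : sin (pi / 6) = 1 / 2 :> R.
Proof.
have p0 := pi_gt0 R.
have s0 : 0 < sin (pi / 6) :> R by apply: sin_gt0_pihalf; apply/andP; split; lra.
have : cos (pi / 6 + pi / 6) = sin (pi / 6) :> R.
  by rewrite -cosBpihalf -cosN; congr cos; field.
rewrite cosD -!expr2 cos2sin2 => h.
have : (sin (pi / 6) - 1 / 2) * (sin (pi / 6) + 1) = 0 :> R by lra.
by move/eqP; rewrite mulf_eq0 => /orP[] /eqP; lra.
Qed.

Lemma cos_pi6 : cos (pi / 6) = Num.sqrt 3 / 2 :> R.
Proof.
have p0 := pi_gt0 R; have s3 := sqr_sqrt3; have s0 := sqrt3_gt0.
have c0 : 0 < cos (pi / 6) :> R by apply: cos_gt0_pihalf; apply/andP; split; lra.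
have := cos2Dsin2 (pi / 6 : R); rewrite sin_pi6 => h.
have : (cos (pi / 6) - Num.sqrt 3 / 2) * (cos (pi / 6) + Num.sqrt 3 / 2) = 0 :> R.
  by lra.
by move/eqP; rewrite mulf_eq0 => /orP[] /eqP; lra.
Qed.

Lemma cos_sin_pi4 : cos (pi / 4) = Num.sqrt 2 / 2 :> R /\
  sin (pi / 4) = Num.sqrt 2 / 2 :> R.
Proof.
have p0 := pi_gt0 R; have s2 : Num.sqrt 2 ^+ 2 = 2 :> R by rewrite sqr_sqrtr.
have s0 : 0 < Num.sqrt 2 :> R by rewrite sqrtr_gt0.
have c0 : 0 < cos (pi / 4) :> R by apply: cos_gt0_pihalf; apply/andP; split; lra.
have e : sin (pi / 4) = cos (pi / 4) :> R.
  by rewrite -cosBpihalf -cosN; congr cos; field.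
have := cos2Dsin2 (pi / 4 : R); rewrite e => h.
have : (cos (pi / 4) - Num.sqrt 2 / 2) * (cos (pi / 4) + Num.sqrt 2 / 2) = 0 :> R.
  by lra.
by move/eqP; rewrite mulf_eq0 => /orP[] /eqP h1; split; lra.
Qed.

(** The circumradius of the regular hexagon of inradius 1. *)
Definition rho : R := 2 / Num.sqrt 3.

Lemma sqr_rho : rho ^+ 2 = 4 / 3.
Proof. by rewrite /rho expr_div_n sqr_sqrt3; lra. Qed.

Lemma rho_gt0 : 0 < rho.
Proof. by rewrite divr_gt0// sqrt3_gt0. Qed.

Lemma sqrt3_rho : Num.sqrt 3 = 3 / 2 * rho.
Proof.
have s3 := sqr_sqrt3; have s0 := sqrt3_gt0.
by rewrite /rho; apply: (mulIf (negbT (gt_eqF s0))); rewrite -expr2 s3; field; rewrite gt_eqF.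
Qed.

Lemma rho_sqrt3 : rho = 2 / 3 * Num.sqrt 3.
Proof. by have := sqrt3_rho; lra. Qed.

(** For s <= pi / 6 the left-hand side is the area that the hexagonal density
    requires in a sector of angle 2 s, and the right-hand side is the
    triangle spanned by the chord; equality holds at both ends. *)
Lemma triangle_bound s : 0 <= s <= pi / 6 ->
  2 * Num.sqrt 3 / pi * s <= 4 / 3 * (cos s * sin s).
Proof.
move=> s06; have p0 := pi_gt0 R; rewrite -subr_ge0.
pose k : R := 2 * Num.sqrt 3 / pi.
apply: (@concave_ge0 (fun x => 4 / 3 * (cos x * sin x) - k * x)
  (fun x => 4 / 3 * (cos x ^+ 2 - sin x ^+ 2) - k)
  (fun x => - (16 / 3 * (cos x * sin x))) 0 (pi / 6) s) => //.
- by move=> x; apply: is_derive_eq; rewrite /GRing.scale /=; field.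
- by move=> x; apply: is_derive_eq; rewrite /GRing.scale /=; field.
- move=> x /andP[x0 x6]; rewrite oppr_le0 mulr_ge0// mulr_ge0// ltW//.
    by apply: cos_gt0_pihalf; apply/andP; split; lra.
  by apply: sin_gt0_pihalf; apply/andP; split; lra.
- by rewrite sin0; lra.
- rewrite sin_pi6 cos_pi6 /k le_eqVlt; apply/orP; left; apply/eqP.
  by rewrite (mulrA (_ / pi)) divfK ?gt_eqF//; lra.
Qed.

(** For larger angles the chord meets the unit disc, and the parabolic cap
    beyond it is counted too. Equality holds again at pi / 6; at pi / 4 the
    margin is about 0.0004, so the angle could not be allowed to grow much
    further. *)
Lemma cap_bound s : pi / 6 <= s <= pi / 4 ->
  2 * Num.sqrt 3 / pi * s <= 4 / 3 * rho * sin s - 4 / 9 * (cos s * sin s).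
Proof.
move=> s64; have p0 := pi_gt0 R; rewrite -subr_ge0.
pose k : R := 2 * Num.sqrt 3 / pi.
apply: (@concave_ge0
  (fun x => 4 / 3 * rho * sin x - 4 / 9 * (cos x * sin x) - k * x)
  (fun x => 4 / 3 * rho * cos x - 4 / 9 * (cos x ^+ 2 - sin x ^+ 2) - k)
  (fun x => - (4 / 3 * rho * sin x) + 16 / 9 * (cos x * sin x))
  (pi / 6) (pi / 4) s) => //.
- by move=> x; apply: is_derive_eq; rewrite /GRing.scale /=; field.
- by move=> x; apply: is_derive_eq; rewrite /GRing.scale /=; field.
- move=> x /andP[x0 x6].
  have sx : 0 < sin x by apply: sin_gt0_pihalf; apply/andP; split; lra.
  have : cos x < cos (pi / 6) by rewrite ltr_cos// in_itv/=; apply/andP; split; lra.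
  rewrite cos_pi6 sqrt3_rho => h.
  have -> : - (4 / 3 * rho * sin x) + 16 / 9 * (cos x * sin x) =
    - (16 / 9 * sin x * (3 / 2 * rho / 2 - cos x)) by field.
  by rewrite oppr_le0 mulr_ge0// ?mulr_ge0 ?subr_ge0 ?ltW.
- rewrite sin_pi6 cos_pi6 (_ : k * (pi / 6) = Num.sqrt 3 / 3).
    rewrite rho_sqrt3.
    by lra.
  by rewrite /k (mulrA (_ / pi)) divfK ?gt_eqF//; lra.
- have [-> ->] := cos_sin_pi4.
  rewrite (_ : k * (pi / 4) = Num.sqrt 3 / 2); last first.
    by rewrite /k (mulrA (_ / pi)) divfK ?gt_eqF//; lra.
  rewrite rho_sqrt3.
  have s2 : Num.sqrt 2 ^+ 2 = 2 :> R by rewrite sqr_sqrtr.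
  have uv0 : 0 < Num.sqrt 2 * Num.sqrt 3 :> R by rewrite mulr_gt0 ?sqrtr_gt0.
  have uv2 : (Num.sqrt 2 * Num.sqrt 3) ^+ 2 = 6 :> R.
    by rewrite exprMn s2 sqr_sqrt3; lra.
  have v2 := sqr_sqrt3; have v0 := sqrt3_gt0.
  set v := Num.sqrt 3 in v0 v2 uv0 uv2 *; set u := Num.sqrt 2 in s2 uv0 uv2 *.
  suff h : 9 * v + 4 <= 8 * (u * v) by lra.
  move: (u * v) uv0 uv2 => w w0 w2.
  rewrite leNgt; apply/negP => h.
  have h2 : 0 < (9 * v + 4 - 8 * w) * (9 * v + 4 + 8 * w).
    by rewrite mulr_gt0//; lra.
  have h3 : 125 < 72 * v by lra.
  have h4 : 0 < (72 * v - 125) * (72 * v + 125) by rewrite mulr_gt0//; lra.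
  lra.
Qed.

(** The proportion of its circumscribed disc that a regular hexagon fills. *)
Definition hexdensity : R := 3 * Num.sqrt 3 / (2 * pi).

(** The right-hand side is the triangle under the chord of a sector of
    half-angle s plus, when the chord meets the unit disc, two thirds of the
    rectangle between the chord and the parallel tangent of this disc. *)
Lemma sector_scalar_bound s : 0 <= s <= pi / 4 ->
  hexdensity * (rho ^+ 2 * s) <= rho * cos s * (rho * sin s) +
    4 / 3 * (rho * sin s) * Num.max 0 (1 - rho * cos s).
Proof.
move=> /andP[s0 s4]; have p0 := pi_gt0 R.
have -> : hexdensity * (rho ^+ 2 * s) = 2 * Num.sqrt 3 / pi * s.
  by rewrite /hexdensity sqr_rho invfM; lra.
have sn0 : 0 <= sin s by apply: sin_ge0_pi; apply/andP; split; lra.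
have r0 := rho_gt0; have r2 := sqr_rho.
have rc : rho * cos s * (rho * sin s) = 4 / 3 * (cos s * sin s).
  by rewrite -r2; ring.
have [s6|s6] := leP s (pi / 6).
  have := @triangle_bound s; rewrite s0 s6 => /(_ isT) h.
  apply: (le_trans h); rewrite rc lerDl mulr_ge0// ?le_max ?lexx//.
  by rewrite mulr_ge0// mulr_ge0// ltW.
have := @cap_bound s; rewrite (ltW s6) s4 => /(_ isT) h.
apply: (le_trans h); rewrite rc.
apply: (@le_trans _ _ (4 / 3 * (cos s * sin s) + 4 / 3 * (rho * sin s) * (1 - rho * cos s))).
  have -> : 4 / 3 * (rho * sin s) * (1 - rho * cos s) =
    4 / 3 * rho * sin s - 4 / 3 * rho ^+ 2 * (cos s * sin s) by ring.
  by rewrite r2; lra.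
rewrite lerD2l ler_wpM2l ?le_max ?lexx ?orbT//.
by rewrite mulr_ge0// mulr_ge0// ltW.
Qed.

End scalar.


(** * Parabolas facing a circle *)

Section parabola.
Context {R : realType}.
Implicit Types D h x y s : R.

(** With e, v the projections to a plane of two orthonormal vectors, this
    is the difference of the squared distances from a point of the plane to
    the line of direction v with foot D e and to the origin; it vanishes on
    a parabola. *)
Definition qform D (e1 e2 v1 v2 : R) x y :=
  D ^+ 2 - 2 * D * (e1 * x + e2 * y) - (v1 * x + v2 * y) ^+ 2.

(** Bessel's inequality for the projections of two orthonormal vectors of
    space to a plane: the only trace that the third dimension leaves. *)
Definition bessel (e1 e2 v1 v2 : R) := forall x y : R,
  (e1 * x + e2 * y) ^+ 2 + (v1 * x + v2 * y) ^+ 2 <= x ^+ 2 + y ^+ 2.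

Lemma qform_concave D (e1 e2 v1 v2 : R) x y s : 0 <= s <= 1 ->
  (1 - s) * D ^+ 2 + s * qform D e1 e2 v1 v2 x y <=
  qform D e1 e2 v1 v2 (s * x) (s * y).
Proof.
move=> /andP[s0 s1]; rewrite -subr_ge0.
have -> : qform D e1 e2 v1 v2 (s * x) (s * y) -
  ((1 - s) * D ^+ 2 + s * qform D e1 e2 v1 v2 x y) =
  s * (1 - s) * (v1 * x + v2 * y) ^+ 2 by rewrite /qform; ring.
by rewrite mulr_ge0 ?sqr_ge0// mulr_ge0// subr_ge0.
Qed.

Lemma qform_ge D (e1 e2 v1 v2 : R) x y : bessel e1 e2 v1 v2 ->
  (D - (e1 * x + e2 * y)) ^+ 2 - (x ^+ 2 + y ^+ 2) <= qform D e1 e2 v1 v2 x y.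
Proof. by move=> /(_ x y) h; rewrite /qform; lra. Qed.

Lemma qform_le0_dot D (e1 e2 v1 v2 : R) x y r : bessel e1 e2 v1 v2 -> 0 <= r ->
  x ^+ 2 + y ^+ 2 <= r ^+ 2 -> qform D e1 e2 v1 v2 x y <= 0 ->
  D - r <= e1 * x + e2 * y.
Proof.
move=> b r0 xyr q0; have h := qform_ge D x y b.
rewrite lerBlDr -lerBlDl; set a := e1 * x + e2 * y in h *.
rewrite leNgt; apply/negP => ra.
have : 0 < (D - a - r) * (D - a + r) by rewrite mulr_gt0//; lra.
lra.
Qed.

Lemma rho_lt2 : (rho : R) < 2.
Proof. by have := @sqr_rho R; have := @rho_gt0 R; move=> r0 r2; nra. Qed.

(** The discriminant of the quadratic polynomial that a vertical line cuts on
    the form; it is affine in the abscissa x of the line. *)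
Definition slice_form D (e1 v1 : R) h x :=
  D ^+ 2 - 2 * (D * e1) * x - 2 * v1 ^+ 2 * x * h + v1 ^+ 2 * h ^+ 2.

(** The chord x = h, |y| <= w of the circle of radius rho, both ends of which
    lie on the parabola. *)
Section chord.
Variables (D e1 e2 v1 v2 h w : R).
Hypotheses (D2 : 2 <= D) (ev : bessel e1 e2 v1 v2).
Hypotheses (h0 : 0 < h) (w0 : 0 < w) (hw : h ^+ 2 + w ^+ 2 = rho ^+ 2).
Hypotheses (q1 : qform D e1 e2 v1 v2 h w = 0) (q2 : qform D e1 e2 v1 v2 h (- w) = 0).
Local Notation q := (qform D e1 e2 v1 v2).

Let De2 : D * e2 = - (v1 * v2 * h).
Proof.
have : (D * e2 + v1 * v2 * h) * w = 0 by move: q1 q2; rewrite /qform; lra.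
by move/eqP; rewrite mulf_eq0 (gt_eqF w0) orbF => /eqP; lra.
Qed.

Let Dh : D ^+ 2 = 2 * (D * e1) * h + v1 ^+ 2 * h ^+ 2 + v2 ^+ 2 * w ^+ 2.
Proof. by move: q1 q2; rewrite /qform; lra. Qed.

Let e1h : D - rho <= e1 * h.
Proof.
have r0 : 0 <= (rho : R) by exact/ltW/rho_gt0.
have hw1 : h ^+ 2 + w ^+ 2 <= rho ^+ 2 by rewrite hw.
have hw2 : h ^+ 2 + (- w) ^+ 2 <= rho ^+ 2 by rewrite sqrrN hw.
have := qform_le0_dot (D := D) ev r0 hw1; rewrite q1 lexx => /(_ isT) a1.
have := qform_le0_dot (D := D) ev r0 hw2; rewrite q2 lexx => /(_ isT) a2.
lra.
Qed.

Let e10 : 0 < e1.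
Proof.
have r2 := rho_lt2; have := e1h; have := D2 => d2 eh.
have : 0 < e1 * h by lra.
by rewrite pmulr_lgt0.
Qed.

Let h_lt_rho : h < rho.
Proof.
rewrite -(@ltr_pXn2r _ 2)// ?nnegrE ?(ltW h0) ?(ltW (@rho_gt0 R))//.
by rewrite -hw ltrDl exprn_gt0.
Qed.

Lemma qform_on_chord y : q h y = v2 ^+ 2 * (w ^+ 2 - y ^+ 2).
Proof.
have -> : q h y = D ^+ 2 - 2 * (D * e1) * h - 2 * (D * e2) * y -
   (v1 * h + v2 * y) ^+ 2 by rewrite /qform; ring.
by rewrite De2 Dh; ring.
Qed.

Let De1_gt : 2 * rho < 2 * (D * e1).
Proof.
have r2 := rho_lt2; have rr := @sqr_rho R; have r0 := @rho_gt0 R.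
have := e1h; have := D2 => d2 eh; rewrite ltr_pM2l//.
(* D e1 h >= D (D - rho) >= 2 (2 - rho) > rho ^ 2 > rho h *)
have a1 : D * (D - rho) <= D * (e1 * h) by rewrite ler_wpM2l//; lra.
have a2 : 2 * (2 - rho) <= D * (D - rho) by nra.
have a3 : rho < (4 / 3 : R).
  rewrite -(@ltr_pXn2r _ 2)// ?nnegrE ?(ltW r0)//; rewrite rr; lra.
have a4 : rho * h < rho ^+ 2 by rewrite expr2 ltr_pM2l.
have : rho * h < D * e1 * h by rewrite -mulrA; lra.
by rewrite ltr_pM2r.
Qed.

Let v_le1 : v1 ^+ 2 + v2 ^+ 2 <= 1.
Proof.
have := ev v1 v2; rewrite -!expr2; set t := v1 ^+ 2 + v2 ^+ 2.
move=> ht; have t0 : 0 <= t by rewrite addr_ge0 ?sqr_ge0.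
have := sqr_ge0 (e1 * v1 + e2 * v2) => s0.
rewrite leNgt; apply/negP => t1.
have : 0 < t * (t - 1) by rewrite mulr_gt0//; lra.
lra.
Qed.

(** On the circle the quadratic form factors through x - h, and the other
    factor is negative because the parabola is flatter than the circle. *)
Lemma qform_on_circle x y : x ^+ 2 + y ^+ 2 = rho ^+ 2 ->
  exists2 B, B < 0 & q x y = (x - h) * B.
Proof.
move=> xy.
exists ((v2 ^+ 2 - v1 ^+ 2) * (x + h) - 2 * (v1 * v2) * y - 2 * (D * e1)).
  rewrite subr_lt0; apply: le_lt_trans De1_gt.
  set X := x + h.
  have r0 := @rho_gt0 R.
  have xr : x <= rho.
    rewrite leNgt; apply/negP => rx.
    have : 0 < (x - rho) * (x + rho) by rewrite mulr_gt0//; lra.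
    have := sqr_ge0 y; lra.
  have XY : X ^+ 2 + y ^+ 2 <= 4 * rho ^+ 2.
    have : x * h <= rho ^+ 2.
      rewrite expr2; apply: (@le_trans _ _ (rho * h)); first by rewrite ler_pM2r.
      by rewrite ler_pM2l// ltW.
    have : h ^+ 2 <= rho ^+ 2 by rewrite -hw lerDl sqr_ge0.
    have -> : X ^+ 2 + y ^+ 2 = rho ^+ 2 + 2 * (x * h) + h ^+ 2.
      by rewrite -xy /X; ring.
    lra.
  set L := _ - _.
  have LE : L ^+ 2 <= (2 * rho) ^+ 2.
    have L2 : L ^+ 2 + (2 * (v1 * v2) * X + (v2 ^+ 2 - v1 ^+ 2) * y) ^+ 2 =
      (v1 ^+ 2 + v2 ^+ 2) ^+ 2 * (X ^+ 2 + y ^+ 2) by rewrite /L; ring.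
    have := sqr_ge0 (2 * (v1 * v2) * X + (v2 ^+ 2 - v1 ^+ 2) * y).
    have : (v1 ^+ 2 + v2 ^+ 2) ^+ 2 * (X ^+ 2 + y ^+ 2) <= 1 * (4 * rho ^+ 2).
      apply: ler_pM => //; rewrite ?sqr_ge0 ?addr_ge0 ?sqr_ge0//.
      by rewrite expr_le1// addr_ge0 ?sqr_ge0.
    lra.
  rewrite leNgt; apply/negP => rL.
  have : 0 < (L - 2 * rho) * (L + 2 * rho) by rewrite mulr_gt0//; lra.
  lra.
have -> : q x y = D ^+ 2 - 2 * (D * e1) * x - 2 * (D * e2) * y -
   (v1 * x + v2 * y) ^+ 2 by rewrite /qform; ring.
rewrite De2 Dh.
have -> : w ^+ 2 = x ^+ 2 + y ^+ 2 - h ^+ 2 by rewrite xy -hw; ring.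
ring.
Qed.

Lemma qform_circle_lt0 x y : x ^+ 2 + y ^+ 2 = rho ^+ 2 -> (q x y < 0) = (h < x).
Proof.
move=> xy; have [B B0 ->] := qform_on_circle xy.
by rewrite nmulr_llt0// subr_gt0.
Qed.

(** The region where the form is nonnegative is star-shaped with respect to
    the origin, and contains the chord. *)
Lemma qform_triangle_gt0 x y : 0 < x -> x < h -> `|y| * h < x * w -> 0 < q x y.
Proof.
move=> x0 xh yw.
have -> : q x y = q (x / h * h) (x / h * (y * (h / x))).
  by congr q; field; rewrite ?gt_eqF.
have s01 : 0 <= x / h <= 1.
  by rewrite divr_ge0 ?(ltW x0) ?(ltW h0)//= ler_pdivrMr// mul1r ltW.
apply: lt_le_trans (qform_concave D e1 e2 v1 v2 h (y * (h / x)) s01).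
rewrite qform_on_chord.
have y2 : (y * (h / x)) ^+ 2 <= w ^+ 2.
  rewrite -real_normK ?num_real// ler_sqr ?nnegrE ?normr_ge0 ?(ltW w0)//.
  rewrite normrM [`|h / x|]gtr0_norm ?divr_gt0// mulrA ler_pdivrMr//.
  by rewrite [w * x]mulrC ltW.
have d0 : 0 < D by have := D2; lra.
have a1 : 0 < (1 - x / h) * D ^+ 2.
  by rewrite mulr_gt0 ?exprn_gt0// subr_gt0 ltr_pdivrMr// mul1r.
have a2 : 0 <= x / h * (v2 ^+ 2 * (w ^+ 2 - (y * (h / x)) ^+ 2)).
  apply: mulr_ge0; first by apply: divr_ge0; apply: ltW.
  apply: mulr_ge0; first exact: sqr_ge0.
  by rewrite subr_ge0.
by rewrite (lt_le_trans a1)// lerDl.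
Qed.

(** A point beyond the chord and outside the angle that it spans would pull,
    by concavity, a point of the line of the chord outside the chord into the
    open region. *)
Lemma qform_gt0_cone x y : h <= x -> 0 < q x y -> `|y| * h < x * w.
Proof.
move=> hx qxy; rewrite ltNge; apply/negP => yw.
have x0 : 0 < x by exact: lt_le_trans h0 hx.
have s01 : 0 <= h / x <= 1.
  by rewrite divr_ge0 ?(ltW h0) ?(ltW x0)//= ler_pdivrMr// mul1r.
have := qform_concave D e1 e2 v1 v2 x y s01.
rewrite divfK ?gt_eqF// qform_on_chord.
have y2 : w ^+ 2 <= (h / x * y) ^+ 2.
  rewrite -[leRHS]real_normK ?num_real// ler_sqr ?nnegrE ?(ltW w0)//.
  rewrite normrM gtr0_norm ?divr_gt0// mulrAC ler_pdivlMr//.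
  by rewrite mulrC [leRHS]mulrC.
have : v2 ^+ 2 * (w ^+ 2 - (h / x * y) ^+ 2) <= 0.
  by rewrite mulr_ge0_le0 ?sqr_ge0// subr_le0.
have : 0 < h / x * q x y by rewrite mulr_gt0// divr_gt0.
have : 0 <= (1 - h / x) * D ^+ 2.
  by rewrite mulr_ge0 ?sqr_ge0// subr_ge0; case/andP: s01.
lra.
Qed.

Lemma cone_circle x y : x ^+ 2 + y ^+ 2 = rho ^+ 2 ->
  (`|y| * h < x * w) = (h < x).
Proof.
move=> xy.
have key : (x * w) ^+ 2 - (`|y| * h) ^+ 2 = rho ^+ 2 * (x ^+ 2 - h ^+ 2).
  rewrite [(x * w) ^+ 2]exprMn [(`|y| * h) ^+ 2]exprMn real_normK ?num_real//.
  have -> : y ^+ 2 = rho ^+ 2 - x ^+ 2 by lra.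
  have -> : w ^+ 2 = rho ^+ 2 - h ^+ 2 by have := hw; lra.
  ring.
have r2 : 0 < rho ^+ 2 :> R by rewrite exprn_gt0// rho_gt0.
have yh : 0 <= `|y| * h by rewrite mulr_ge0// ltW.
apply/idP/idP => [yx|hx].
  have x0 : 0 < x by have := le_lt_trans yh yx; rewrite pmulr_lgt0.
  have : 0 < rho ^+ 2 * (x ^+ 2 - h ^+ 2).
    by rewrite -key subr_gt0 ltr_sqr ?nnegrE ?(ltW (le_lt_trans yh yx)).
  rewrite pmulr_rgt0// subr_gt0 ltr_sqr// nnegrE ltW//.
have x0 : 0 < x by exact: lt_trans h0 hx.
have xw : 0 <= x * w by rewrite mulr_ge0 ?(ltW x0) ?(ltW w0).
rewrite -ltr_sqr ?nnegrE// -subr_gt0 key mulr_gt0// subr_gt0.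
by rewrite ltr_sqr ?nnegrE ?(ltW h0) ?(ltW x0).
Qed.

Lemma qform_gt0_disc x y : h <= x -> 0 < q x y -> x ^+ 2 + y ^+ 2 < rho ^+ 2.
Proof.
move=> hx qxy; have cone := qform_gt0_cone hx qxy.
have x0 : 0 < x by exact: lt_le_trans h0 hx.
have r0 := @rho_gt0 R.
rewrite ltNge; apply/negP => rxy.
pose r := Num.sqrt (x ^+ 2 + y ^+ 2).
have rr : r ^+ 2 = x ^+ 2 + y ^+ 2 by rewrite sqr_sqrtr// addr_ge0 ?sqr_ge0.
have r1 : rho <= r by rewrite -ler_sqr ?nnegrE ?sqrtr_ge0 ?(ltW r0)// rr.
have r_gt0 : 0 < r by lra.
have s01 : 0 <= rho / r <= 1.
  by rewrite divr_ge0 ?(ltW r0) ?(ltW r_gt0)//= ler_pdivrMr// mul1r.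
have circ : (rho / r * x) ^+ 2 + (rho / r * y) ^+ 2 = rho ^+ 2.
  have e : rho / r * r = rho by rewrite divfK// gt_eqF.
  transitivity ((rho / r) ^+ 2 * (x ^+ 2 + y ^+ 2)); [ring | rewrite -rr -{2}e; ring].
have := qform_circle_lt0 circ; rewrite -(cone_circle circ).
rewrite normrM [`|rho / r|]gtr0_norm ?divr_gt0// -2!(mulrA (rho / r)).
rewrite ltr_pM2l ?divr_gt0// cone.
have := qform_concave D e1 e2 v1 v2 x y s01 => c1 c2.
have : 0 < rho / r * q x y by rewrite mulr_gt0// divr_gt0.
have : 0 <= (1 - rho / r) * D ^+ 2.
  by rewrite mulr_ge0 ?sqr_ge0// subr_ge0; case/andP: s01.
lra.
Qed.

Lemma qform_unit_ge0 : h < 1 -> 0 <= D ^+ 2 - 2 * (D * e1) - v1 ^+ 2.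
Proof.
move=> h1; have := qform_ge D 1 0 ev; rewrite /qform.
have : e1 <= 1.
  have := ev e1 e2; rewrite -!expr2; set t := e1 ^+ 2 + e2 ^+ 2.
  move=> ht; have t0 : 0 <= t by rewrite addr_ge0 ?sqr_ge0.
  have := sqr_ge0 (v1 * e1 + v2 * e2) => s0.
  rewrite leNgt; apply/negP => t1.
  have te : e1 ^+ 2 <= t by rewrite lerDl sqr_ge0.
  have : 1 < t by apply: lt_le_trans te; rewrite exprn_egt1.
  move=> tt; have : 0 < t * (t - 1) by rewrite mulr_gt0//; lra.
  lra.
have d2 := D2; move=> e11; have : 0 <= (D - e1 - 1) * (D - e1 + 1) by rewrite mulr_ge0//; lra.
lra.
Qed.

Local Notation V := (v2 ^+ 2).
Local Notation L := (slice_form D e1 v1 h).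

Lemma qform_slice x y : V * q x y =
  V * L x - (V * y + v1 * v2 * (x - h)) ^+ 2.
Proof.
have -> : q x y = D ^+ 2 - 2 * (D * e1) * x - 2 * (D * e2) * y -
   (v1 * x + v2 * y) ^+ 2 by rewrite /qform; ring.
by rewrite De2 /slice_form; ring.
Qed.

Lemma leading_gt0 : h < 1 -> 0 < V.
Proof.
move=> h1; rewrite lt_neqAle sqr_ge0 andbT; apply/eqP => V0.
have := qform_unit_ge0 h1; have := Dh; rewrite -V0 mul0r addr0 => -> .
have d0 : 0 < D by have := D2; lra.
have : 0 < D * e1 by rewrite mulr_gt0.
have := sqr_ge0 v1 => v10 De.
have a1 : 0 < (D * e1) * (1 - h) by rewrite mulr_gt0 ?subr_gt0.
have a2 : 0 <= v1 ^+ 2 * (1 - h ^+ 2).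
  by rewrite mulr_ge0// subr_ge0 expr_le1 ?ltW.
lra.
Qed.

(** The affine function is known at the chord, x = h, and is nonnegative at
    x = 1 because the region contains the unit disc. *)
Lemma slice_discriminant x : h < 1 -> h <= x <= 1 ->
  V * w ^+ 2 * ((1 - x) / (1 - h)) <= L x.
Proof.
move=> h1 /andP[hx x1].
have Lh : L h = V * w ^+ 2 by rewrite /slice_form Dh; ring.
have L1 : 0 <= L 1.
  have -> : L 1 = D ^+ 2 - 2 * (D * e1) - v1 ^+ 2 + v1 ^+ 2 * (1 - h) ^+ 2.
    by rewrite /slice_form; ring.
  by rewrite addr_ge0 ?qform_unit_ge0// mulr_ge0 ?sqr_ge0.
have -> : L x = L h * ((1 - x) / (1 - h)) + L 1 * ((x - h) / (1 - h)).
  by rewrite /slice_form; field; lra.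
rewrite Lh lerDl mulr_ge0// divr_ge0//; lra.
Qed.

End chord.

End parabola.


(** * The area of a sector and of its part inside a parabola *)

Section sector.
Context {R : realType}.
Notation T1 := (measurableTypeR R).
Notation leb := (@lebesgue_measure R).
Implicit Types (A : set (T1 * T1)).

Lemma measurable_slice A (x : R) : measurable A ->
  measurable ([set y | A (x, y)] : set T1).
Proof.
move=> mA; have := @measurable_xsection _ _ _ _ A x mA.
by congr measurable; apply/seteqP; split => y /=; rewrite /xsection/= inE.
Qed.

Lemma leb_slice_le A (x c : R) : measurable A ->
  (forall y, A (x, y) -> y ^+ 2 < c) ->
  (leb [set y | A (x, y)] <= (2 * Num.sqrt c)%:E)%E.
Proof.
move=> mA Ac; rewrite -leb_sqr_lt; apply: le_measure; rewrite ?inE//.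
  exact: measurable_slice.
by apply: measurable_set_lt => //; exact: measurable_funX.
Qed.

Lemma leb_slice_ge A (x b c : R) : measurable A ->
  (forall y, (y + b) ^+ 2 < c -> A (x, y)) ->
  ((2 * Num.sqrt c)%:E <= leb [set y | A (x, y)])%E.
Proof.
move=> mA Ac; rewrite -leb_sqr_lt.
have mc : measurable ([set y : R | y ^+ 2 < c] : set T1).
  by apply: measurable_set_lt => //; exact: measurable_funX.
rewrite -((mpreserving_translate b).2 _ mc); apply: le_measure; rewrite ?inE//.
  rewrite -[X in measurable X]setTI; apply: (mpreserving_translate b).1 => //.
exact: measurable_slice.
Qed.

Lemma leb_slice_empty A (x : R) : (forall y, ~ A (x, y)) ->
  leb [set y | A (x, y)] = 0%E.
Proof.
move=> Ac; rewrite (_ : [set y | _] = set0) ?measure0//.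
by apply/seteqP; split => y //= /Ac.
Qed.

(** The sector of the disc of radius rho bounded by the rays through the
    points (h, w) and (h, - w). *)
Definition cone (h w : R) : set (T1 * T1) := [set p |
  (p.1 : R) ^+ 2 + (p.2 : R) ^+ 2 < rho ^+ 2 /\ `|p.2 : R| * h < (p.1 : R) * w].

Lemma measurable_open_disc (c : R) : measurable
  ([set p | (p.1 : R) ^+ 2 + (p.2 : R) ^+ 2 < c] : set (T1 * T1)).
Proof. exact: (measurable_set_lt measurable_sqdist2). Qed.

Lemma measurable_cone h w : measurable (cone h w).
Proof.
apply: measurableI; first exact: measurable_open_disc.
by apply: measurable_set_lt; apply: measurable_funM => //; exact: measurableT_comp.
Qed.

Lemma measurable_left (h : R) :
  measurable ([set p | (p.1 : R) < h] : set (T1 * T1)).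
Proof. by apply: measurable_set_lt. Qed.

Lemma area_left_right A (h : R) : measurable A ->
  (area A = area (A `&` [set p | ((p.1 : R) < h)%R]) +
            area (A `&` [set p | (h <= (p.1 : R))%R]))%E.
Proof.
move=> mA; rewrite -measureU.
- congr (area _); rewrite -setIUr -[LHS]setIT; congr setI.
  by apply/seteqP; split => p //= _; case: ltP; [left|right].
- by apply: measurableI => //; exact: measurable_left.
- by apply: measurableI => //; exact: measurable_set_le.
- rewrite setIACA [X in _ `&` X](_ : _ = set0) ?setI0//.
  by apply/seteqP; split => p //= []; rewrite leNgt => ->.
Qed.

Section halfangle.
Variable s : R.
Hypothesis s04 : 0 < s < pi / 4.
Let h := rho * cos s.
Let w := rho * sin s.

Lemma sector_dims : [/\ 0 < h, 0 < w, h ^+ 2 + w ^+ 2 = rho ^+ 2 & h < rho].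
Proof.
have /andP[s0 s4] := s04; have p0 := pi_gt0 R; have r0 := @rho_gt0 R.
have c0 : 0 < cos s by apply: cos_gt0_pihalf; apply/andP; split; lra.
have si0 : 0 < sin s by apply: sin_gt0_pihalf; apply/andP; split; lra.
have hw : h ^+ 2 + w ^+ 2 = rho ^+ 2.
  transitivity (rho ^+ 2 * (cos s ^+ 2 + sin s ^+ 2)); first by rewrite /h /w; ring.
  by rewrite cos2Dsin2 mulr1.
have h0 : 0 < h by rewrite mulr_gt0.
have w0 : 0 < w by rewrite mulr_gt0.
split => //; rewrite -ltr_sqr ?nnegrE ?(ltW h0) ?(ltW r0)// -hw ltrDl.
by rewrite exprn_gt0.
Qed.

Let h0 : 0 < h. Proof. by have [] := sector_dims. Qed.
Let w0 : 0 < w. Proof. by have [] := sector_dims. Qed.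
Let hw : h ^+ 2 + w ^+ 2 = rho ^+ 2. Proof. by have [] := sector_dims. Qed.
Let hr : h < rho. Proof. by have [] := sector_dims. Qed.

Let tri (x : R) := 2 * (w / h) * x.
Let Tri (x : R) := w / h * x ^+ 2.

Let dTri (x : R) : is_derive x 1 Tri (tri x).
Proof. by apply: is_derive_eq; rewrite /GRing.scale /=; rewrite /tri; ring. Qed.

Let ctri : continuous (tri : R -> R).
Proof. by move=> x; apply: cvgM; [exact: cvg_cst|exact: cvg_id]. Qed.

Lemma area_cone_le : (area (cone h w) <= (rho ^+ 2 * s)%:E)%E.
Proof.
have r0 := @rho_gt0 R; have p0 := pi_gt0 R; have /andP[s0 s4] := s04.
have mC := measurable_cone h w.
rewrite (area_left_right h mC).
have -> : rho ^+ 2 * s = h * w + (rho ^+ 2 * s - h * w) by ring.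
rewrite EFinD; apply: leeD.
  have mC1 : measurable (cone h w `&` [set p | (p.1 : R) < h]).
    by apply: measurableI => //; exact: measurable_left.
  rewrite area_slices//.
  have -> : h * w = Tri h - Tri 0 by rewrite /Tri; field; rewrite gt_eqF.
  apply: (@integral_le_primitive R _ tri Tri) => //.
  - exact: measurable_slice_length.
  - exact: continuous_subspaceT.
  - by apply: continuous_subspaceT => x; exact: is_derive_continuous (dTri x).
  - move=> x xh; apply: leb_slice_empty => y [/= [_ yx] xh'].
    have x0 : 0 < x * w.
      by apply: le_lt_trans yx; rewrite mulr_ge0// ltW.
    by move: x0; rewrite pmulr_lgt0// => x0; move: xh; rewrite (ltW x0) (ltW xh').
  - move=> x /andP[x0 xh].
    have xwh : 0 < x * w / h := divr_gt0 (mulr_gt0 x0 w0) h0.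
    rewrite (_ : tri x = 2 * Num.sqrt ((x * w / h) ^+ 2)).
      apply: leb_slice_le => // y [/= [_ yx] _].
      rewrite -[ltLHS]real_normK ?num_real//.
      by rewrite ltr_sqr ?nnegrE ?normr_ge0 ?(ltW xwh)// ltr_pdivlMr.
    rewrite sqrtr_sqr (gtr0_norm xwh).
    by rewrite /tri; ring.
have mC2 : measurable (cone h w `&` [set p | h <= (p.1 : R)]).
  by apply: measurableI => //; exact: measurable_set_le.
rewrite area_slices//.
have hwr : halfchord rho h = w.
  rewrite /halfchord -hw (_ : _ - _ = w ^+ 2); last by ring.
  by rewrite sqrtr_sqr ger0_norm// ltW.
have -> : rho ^+ 2 * s - h * w = circle_primitive rho rho - circle_primitive rho h.
  rewrite /circle_primitive hwr /halfchord subrr sqrtr0 divff ?gt_eqF// acos1.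
  have -> : h / rho = cos s by rewrite /h mulrC mulKf// gt_eqF.
  by rewrite cosK ?in_itv/= ?(ltW s0)//=; [ring|lra].
apply: (@integral_le_primitive R _ (fun x => 2 * halfchord rho x)) => //.
- exact: measurable_slice_length.
- apply: continuous_subspaceT => x.
  by apply: cvgM; [exact: cvg_cst|exact: continuous_halfchord].
- apply: within_continuous_circle_primitive => //.
  by rewrite (le_trans _ (ltW h0))// oppr_le0 ltW.
- move=> x /andP[hx xr]; apply: is_derive_circle_primitive => //.
  by rewrite xr andbT (lt_trans _ (lt_trans h0 hx))// oppr_lt0.
- move=> x xh; apply: leb_slice_empty => y [/= [yx _] xh'].
  have : x ^+ 2 < rho ^+ 2 by apply: le_lt_trans yx; rewrite lerDl sqr_ge0.
  rewrite ltr_sqr ?nnegrE ?(ltW r0) ?(le_trans (ltW h0) xh')// => xr.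
  by move: xh; rewrite xh' (ltW xr).
- move=> x _; apply: leb_slice_le => // y [/= [yx _] xh'].
  by rewrite ltrBrDl.
Qed.

Variables (D e1 e2 v1 v2 : R).
Hypotheses (D2 : 2 <= D) (ev : bessel e1 e2 v1 v2).
Hypotheses (q1 : qform D e1 e2 v1 v2 h w = 0) (q2 : qform D e1 e2 v1 v2 h (- w) = 0).

Let kept : set (T1 * T1) :=
  cone h w `&` [set p | 0 < qform D e1 e2 v1 v2 p.1 p.2].

Lemma measurable_qform :
  measurable_fun setT (fun p : T1 * T1 => qform D e1 e2 v1 v2 p.1 p.2).
Proof.
apply: measurable_funB.
  apply: measurable_funB => //; apply: measurable_funM => //.
  by apply: measurable_funD; apply: measurable_funM.
by apply: measurable_funX; apply: measurable_funD; apply: measurable_funM.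
Qed.

Let mkept : measurable kept.
Proof.
apply: measurableI; first exact: measurable_cone.
by apply: measurable_set_lt => //; exact: measurable_qform.
Qed.

Let area_triangle_ge :
  ((h * w)%:E <= area (kept `&` [set p | ((p.1 : R) < h)%R]))%E.
Proof.
have mC1 : measurable (kept `&` [set p | (p.1 : R) < h]).
  by apply: measurableI => //; exact: measurable_left.
rewrite area_slices//.
have -> : h * w = Tri h - Tri 0 by rewrite /Tri; field; rewrite gt_eqF.
apply: (@integral_ge_primitive R _ tri Tri) => //.
- exact: measurable_slice_length.
- exact: continuous_subspaceT.
- by apply: continuous_subspaceT => x; exact: is_derive_continuous (dTri x).
- move=> x /andP[x0 _]; apply: mulr_ge0 (ltW x0).
  exact: mulr_ge0 (ler0n _ 2) (divr_ge0 (ltW w0) (ltW h0)).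
- move=> x /andP[x0 xh].
  have xwh : 0 < x * w / h := divr_gt0 (mulr_gt0 x0 w0) h0.
  rewrite (_ : tri x = 2 * Num.sqrt ((x * w / h) ^+ 2)).
    apply: (@leb_slice_ge _ _ 0) => // y.
    rewrite addr0 => yx.
    have y2 : `|y| * h < x * w.
      rewrite -ltr_pdivlMr// -ltr_sqr ?nnegrE ?(ltW xwh)//.
      by rewrite real_normK ?num_real.
    split => //; split; last exact: (qform_triangle_gt0 D2 h0 w0 q1 q2).
    split => //=.
    rewrite (@lt_trans _ _ (x ^+ 2 + (x * w / h) ^+ 2))// ?ltrD2l//.
    have -> : x ^+ 2 + (x * w / h) ^+ 2 = (x / h) ^+ 2 * rho ^+ 2.
      by rewrite -hw; field; rewrite gt_eqF.
    have xh0 := divr_ge0 (ltW x0) (ltW h0).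
    rewrite -[ltRHS]mul1r ltr_pM2r; last exact: exprn_gt0 (@rho_gt0 R).
    by rewrite expr_lt1// ltr_pdivrMr// mul1r.
  rewrite sqrtr_sqr ger0_norm; last by rewrite ltW.
  by rewrite /tri; ring.
Qed.

(** Archimedes' quadrature: the vertical slices of the cap between the chord
    and the parabola have lengths at least 2 w sqrt ((1 - x) / (1 - h)), so that
    the cap has at least two thirds of the area of the rectangle between the
    chord and the line x = 1. *)
Let area_cap_ge :
  ((4 / 3 * w * Num.max 0 (1 - h))%:E <=
    area (kept `&` [set p | (h <= (p.1 : R))%R]))%E.
Proof.
have [h1|h1] := leP (1 - h) 0; first by rewrite mulr0 measure_ge0.
have {}h1 : h < 1 by lra.
have mC2 : measurable (kept `&` [set p | h <= (p.1 : R)]).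
  by apply: measurableI => //; exact: measurable_set_le.
rewrite area_slices//.
have h10 : 0 < 1 - h by rewrite subr_gt0.
pose f (x : R) := 2 * w * Num.sqrt ((1 - x) / (1 - h)).
pose F (x : R) := - (4 / 3 * w) * ((1 - x) * Num.sqrt ((1 - x) / (1 - h))).
have -> : 4 / 3 * w * (1 - h) = F 1 - F h.
  by rewrite /F subrr mul0r divff ?gt_eqF// sqrtr1; ring.
have cs : continuous (fun x : R => Num.sqrt ((1 - x) / (1 - h))).
  move=> x; apply: (@continuous_comp _ _ _ (fun y : R => (1 - y) / (1 - h)) Num.sqrt).
    apply: cvgM; last exact: cvg_cst.
    by apply: cvgB; [exact: cvg_cst|exact: cvg_id].
  exact: sqrt_continuous.
apply: (@integral_ge_primitive R _ f F).
- exact: h1.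
- exact: measurable_slice_length.
- by move=> x; exact: measure_ge0.
- apply: continuous_subspaceT => x.
  by apply: cvgM; [exact: cvg_cst|exact: cs].
- apply: continuous_subspaceT => x.
  apply: cvgM; first exact: cvg_cst.
  apply: cvgM; last exact: cs.
  by apply: cvgB; [exact: cvg_cst|exact: cvg_id].
- move=> x /andP[hx x1].
  have u0 : 0 < (1 - x) / (1 - h) by rewrite divr_gt0// subr_gt0.
  have d1 : is_derive x 1 (fun y : R => (1 - y) / (1 - h)) (- (1 - h)^-1).
    by apply: is_derive_eq; rewrite /GRing.scale /=; ring.
  have d2 := @is_derive1_comp R Num.sqrt _ x _ _ (is_derive1_sqrt u0) d1.
  have d3 : is_derive x 1 (fun y : R => 1 - y) (- 1).
    by apply: is_derive_eq; rewrite /GRing.scale /=; ring.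
  have d4 := is_deriveM d3 d2.
  have := @is_deriveZ R _ _ _ (- (4 / 3 * w)) x 1 _ d4.
  move/is_derive_eq; apply; rewrite /GRing.scale /= /f.
  have e : Num.sqrt ((1 - x) / (1 - h)) ^+ 2 = (1 - x) / (1 - h).
    by rewrite sqr_sqrtr// ltW.
  have s0 : 0 < Num.sqrt ((1 - x) / (1 - h)) by rewrite sqrtr_gt0.
  set S := Num.sqrt _ in e s0 *.
  have -> : (1 - h)^-1 = S ^+ 2 / (1 - x).
    by rewrite e; field; rewrite !gt_eqF// subr_gt0.
  by field; rewrite !gt_eqF// subr_gt0.
- move=> x _; apply: mulr_ge0 (sqrtr_ge0 _).
  exact: mulr_ge0 (ler0n _ 2) (ltW w0).
- move=> x /andP[hx x1].
  have V0 := leading_gt0 D2 ev h0 hw q1 q2 h1.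
  have hx1 : h <= x <= 1 by rewrite !ltW.
  have disc := slice_discriminant D2 ev q1 q2 h1 hx1.
  have -> : f x = 2 * Num.sqrt (w ^+ 2 * ((1 - x) / (1 - h))).
    by rewrite sqrtrM ?sqr_ge0// sqrtr_sqr (gtr0_norm w0) /f mulrA.
  apply: (@leb_slice_ge _ _ (v1 * v2 * (x - h) / v2 ^+ 2)) => // y yx.
  have qp : 0 < qform D e1 e2 v1 v2 x y.
    rewrite -(pmulr_rgt0 _ V0) (qform_slice w0 q1 q2) subr_gt0.
    have -> : v2 ^+ 2 * y + v1 * v2 * (x - h) =
       v2 ^+ 2 * (y + v1 * v2 * (x - h) / v2 ^+ 2).
      by rewrite [RHS]mulrDr; congr (_ + _); rewrite [RHS]mulrC divfK// gt_eqF.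
    set Y := y + _ in yx *.
    have -> : (v2 ^+ 2 * Y) ^+ 2 = v2 ^+ 2 * (v2 ^+ 2 * Y ^+ 2) by ring.
    rewrite ltr_pM2l//; apply: lt_le_trans disc.
    by rewrite -(mulrA (v2 ^+ 2)) ltr_pM2l.
  split; last exact: ltW.
  split => //; split => /=.
    exact: (qform_gt0_disc D2 ev h0 w0 hw q1 q2 (ltW hx)).
  exact: (qform_gt0_cone h0 w0 q1 q2 (ltW hx)).
Qed.

Lemma area_kept_ge : ((hexdensity * (rho ^+ 2 * s))%:E <= area kept)%E.
Proof.
have /andP[s0 s4] := s04.
apply: (@le_trans _ _ (h * w + 4 / 3 * w * Num.max 0 (1 - h))%:E).
  by rewrite lee_fin sector_scalar_bound// !ltW.
by rewrite (area_left_right h mkept) EFinD leeD.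
Qed.

End halfangle.

End sector.


(** * The sector bound for a parabola in general position *)

Section sector_bound.
Context {R : realType}.
Notation T1 := (measurableTypeR R).
Notation leb := (@lebesgue_measure R).

(** What a neighbour takes away from the disc of radius rho. *)
Definition cut (D e1 e2 v1 v2 : R) : set (T1 * T1) := [set p |
  (p.1 : R) ^+ 2 + (p.2 : R) ^+ 2 < rho ^+ 2 /\ qform D e1 e2 v1 v2 p.1 p.2 <= 0].

Definition norm2 (x y : R) := Num.sqrt (x ^+ 2 + y ^+ 2).

(** For p <> 0, 0 < shadow_form p says that the form is negative at the
    point of the circle of radius rho in the direction of p. *)
Definition shadow_form (D e1 e2 v1 v2 : R) (x y : R) :=
  2 * D * rho * (e1 * x + e2 * y) * norm2 x y +
  rho ^+ 2 * (v1 * x + v2 * y) ^+ 2 - D ^+ 2 * (x ^+ 2 + y ^+ 2).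

Definition shadow (D e1 e2 v1 v2 : R) : set (T1 * T1) := [set p |
  (p.1 : R) ^+ 2 + (p.2 : R) ^+ 2 < rho ^+ 2 /\
  0 < shadow_form D e1 e2 v1 v2 p.1 p.2].

Section basics.
Variables (D e1 e2 v1 v2 : R).

Lemma measurable_cut : measurable (cut D e1 e2 v1 v2).
Proof.
apply: measurableI; first exact: measurable_open_disc.
by apply: measurable_set_le => //; exact: measurable_qform.
Qed.

Lemma measurable_shadow : measurable (shadow D e1 e2 v1 v2).
Proof.
apply: measurableI; first exact: measurable_open_disc.
apply: measurable_set_lt => //; apply: measurable_funB; last first.
  by apply: measurable_funM => //; exact: measurable_sqdist2.
apply: measurable_funD.
  apply: measurable_funM.
    apply: measurable_funM => //.
    by apply: measurable_funD; apply: measurable_funM.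
  apply: measurableT_comp measurable_sqdist2.
  by apply: continuous_measurable_fun; exact: sqrt_continuous.
apply: measurable_funM => //; apply: measurable_funX.
by apply: measurable_funD; apply: measurable_funM.
Qed.

Lemma sqr_norm2 x y : norm2 x y ^+ 2 = x ^+ 2 + y ^+ 2.
Proof. by rewrite sqr_sqrtr// addr_ge0 ?sqr_ge0. Qed.

Lemma shadow_form_gt0 x y : 0 < norm2 x y ->
  (0 < shadow_form D e1 e2 v1 v2 x y) =
  (qform D e1 e2 v1 v2 (rho / norm2 x y * x) (rho / norm2 x y * y) < 0).
Proof.
move=> r0; have r2 := sqr_norm2 x y.
have -> : shadow_form D e1 e2 v1 v2 x y = - (norm2 x y ^+ 2 *
    qform D e1 e2 v1 v2 (rho / norm2 x y * x) (rho / norm2 x y * y)).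
  by rewrite /shadow_form -r2 /qform; field; rewrite gt_eqF.
by rewrite oppr_gt0 pmulr_rlt0// exprn_gt0.
Qed.

Lemma shadow_form_norm2 x y : 0 < shadow_form D e1 e2 v1 v2 x y -> 0 < norm2 x y.
Proof.
move=> sf; rewrite lt_neqAle sqrtr_ge0 andbT; apply/eqP => r0.
have := sqr_norm2 x y; rewrite -r0 expr0n/= => /esym/eqP.
rewrite paddr_eq0 ?sqr_ge0// !sqrf_eq0 => /andP[/eqP x0 /eqP y0].
move: sf; rewrite /shadow_form -r0 x0 y0.
by rewrite (_ : _ - _ = 0) ?ltxx//; ring.
Qed.

Lemma circle_norm2 x y : 0 < norm2 x y ->
  (rho / norm2 x y * x) ^+ 2 + (rho / norm2 x y * y) ^+ 2 = rho ^+ 2.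
Proof.
move=> r0; have r2 := sqr_norm2 x y.
transitivity ((rho / norm2 x y) ^+ 2 * norm2 x y ^+ 2); first by rewrite r2; ring.
by rewrite expr_div_n divfK// gt_eqF// exprn_gt0.
Qed.

Lemma cut_shadow : 2 <= D -> cut D e1 e2 v1 v2 `<=` shadow D e1 e2 v1 v2.
Proof.
move=> D2 [x y] [/= xy q0]; split => //=.
have rho0 := @rho_gt0 R.
have d20 : 0 < D ^+ 2 by rewrite exprn_gt0//; lra.
have r0 : 0 < norm2 x y.
  rewrite lt_neqAle sqrtr_ge0 andbT; apply/eqP => r0.
  have := sqr_norm2 x y; rewrite -r0 expr0n/= => /esym/eqP.
  rewrite paddr_eq0 ?sqr_ge0// !sqrf_eq0 => /andP[/eqP x0 /eqP y0].
  by move: q0; rewrite /qform x0 y0 !mulr0 addr0 mulr0 expr0n/= !subr0 leNgt d20.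
rewrite shadow_form_gt0//; set r := norm2 x y in r0 *.
have rr : r < rho by rewrite -ltr_sqr ?nnegrE ?(ltW r0) ?(ltW rho0)// sqr_norm2.
have s01 : 0 <= r / rho <= 1.
  by rewrite divr_ge0 ?(ltW r0) ?(ltW rho0)//= ler_pdivrMr// mul1r ltW.
have := qform_concave D e1 e2 v1 v2 (rho / r * x) (rho / r * y) s01.
have e : r / rho * (rho / r) = 1.
  by rewrite mulrA divfK ?gt_eqF// divff// gt_eqF.
rewrite (mulrA (r / rho) _ x) (mulrA (r / rho) _ y) e !mul1r => c.
have s0 : 0 < r / rho by rewrite divr_gt0.
have a1 : 0 < (1 - r / rho) * D ^+ 2.
  by rewrite mulr_gt0// subr_gt0 ltr_pdivrMr// mul1r.
by rewrite -(pmulr_rlt0 _ s0); lra.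
Qed.

End basics.

Section rotation.
Variables (c s D e1 e2 v1 v2 : R).
Hypothesis cs : c ^+ 2 + s ^+ 2 = 1.
Let e1' := c * e1 + s * e2.
Let e2' := c * e2 - s * e1.
Let v1' := c * v1 + s * v2.
Let v2' := c * v2 - s * v1.

Let norm_rot (x y : R) : (c * x - s * y) ^+ 2 + (s * x + c * y) ^+ 2 = x ^+ 2 + y ^+ 2.
Proof.
transitivity ((c ^+ 2 + s ^+ 2) * (x ^+ 2 + y ^+ 2)); first by ring.
by rewrite cs mul1r.
Qed.

Lemma qform_rotation x y :
  qform D e1 e2 v1 v2 (c * x - s * y) (s * x + c * y) =
  qform D e1' e2' v1' v2' x y.
Proof. by rewrite /qform /e1' /e2' /v1' /v2'; congr (_ - _ * _ - _ ^+ 2); ring. Qed.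

Lemma bessel_rotation : bessel e1 e2 v1 v2 -> bessel e1' e2' v1' v2'.
Proof.
move=> ev x y; have := ev (c * x - s * y) (s * x + c * y).
rewrite norm_rot; congr (_ ^+ 2 + _ ^+ 2 <= _); rewrite /e1' /e2' /v1' /v2'; ring.
Qed.

Lemma area_cut_rotation :
  area (cut D e1 e2 v1 v2) = area (cut D e1' e2' v1' v2').
Proof.
rewrite -((mpreserving_rotation cs).2 _ (measurable_cut _ _ _ _ _)).
congr (area _); apply/seteqP.
by split => -[x y] /= [h1 h2]; split; move: h1 h2; rewrite /= ?norm_rot ?qform_rotation.
Qed.

Lemma area_shadow_rotation :
  area (shadow D e1 e2 v1 v2) = area (shadow D e1' e2' v1' v2').
Proof.
rewrite -((mpreserving_rotation cs).2 _ (measurable_shadow _ _ _ _ _)).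
congr (area _).
have sf (x y : R) : shadow_form D e1 e2 v1 v2 (c * x - s * y) (s * x + c * y) =
    shadow_form D e1' e2' v1' v2' x y.
  rewrite /shadow_form /norm2 norm_rot /e1' /e2' /v1' /v2'.
  by congr (_ * _ * _ + _ * _ ^+ 2 - _); ring.
apply/seteqP.
by split => -[x y] /= [h1 h2]; split; move: h1 h2; rewrite /= ?norm_rot ?sf.
Qed.

End rotation.

Definition sector_bound (D e1 e2 v1 v2 : R) :=
  (area (cut D e1 e2 v1 v2) <=
    (1 - hexdensity)%:E * area (shadow D e1 e2 v1 v2))%E.

(** When the chord is vertical, the shadow is the sector that it spans, of
    area rho ^ 2 * s; the complement of the cut in it has at least the
    hexagonal share of this area. *)
Lemma chord_sector_bound s D e1 e2 v1 v2 : 0 < s < pi / 4 -> 2 <= D ->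
    bessel e1 e2 v1 v2 ->
    qform D e1 e2 v1 v2 (rho * cos s) (rho * sin s) = 0 ->
    qform D e1 e2 v1 v2 (rho * cos s) (- (rho * sin s)) = 0 ->
  sector_bound D e1 e2 v1 v2.
Proof.
move=> s04 D2 ev q1 q2; have [h0 w0 hw hr] := sector_dims s04.
have r0 := @rho_gt0 R.
have sE : shadow D e1 e2 v1 v2 = cone (rho * cos s) (rho * sin s).
  have key (x y : R) : 0 < norm2 x y -> (0 < shadow_form D e1 e2 v1 v2 x y) =
      (`|y| * (rho * cos s) < x * (rho * sin s)).
    move=> n0; have circ := circle_norm2 n0.
    rewrite shadow_form_gt0// (qform_circle_lt0 D2 ev h0 w0 hw q1 q2 circ).
    rewrite -(cone_circle h0 w0 hw circ) normrM [`|rho / _|]gtr0_norm ?divr_gt0//.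
    by rewrite -2!(mulrA (rho / _)) ltr_pM2l ?divr_gt0.
  apply/seteqP; split => -[x y] /= [xy h]; split => //=.
    by rewrite -key// (shadow_form_norm2 h).
  rewrite key// sqrtr_gt0 -/(norm2 x y) lt_neqAle addr_ge0 ?sqr_ge0// andbT eq_sym.
  rewrite paddr_eq0 ?sqr_ge0// !sqrf_eq0; apply/negP => /andP[/eqP x0 /eqP y0].
  by move: h; rewrite /= x0 y0 normr0 !mul0r ltxx.
have mc := measurable_cut D e1 e2 v1 v2.
have mk : measurable (cone (rho * cos s) (rho * sin s) `&`
    [set p | 0 < qform D e1 e2 v1 v2 p.1 p.2]).
  apply: measurableI; first exact: measurable_cone.
  by apply: measurable_set_lt => //; exact: measurable_qform.
have split_cone : (area (shadow D e1 e2 v1 v2) = area (cut D e1 e2 v1 v2) +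
    area (cone (rho * cos s) (rho * sin s) `&`
      [set p | (0 < qform D e1 e2 v1 v2 p.1 p.2)%R]))%E.
  rewrite -measureU//.
    congr (area _); apply/seteqP; split => -[x y].
      move=> sxy; have := sxy; rewrite sE => cxy; case: sxy => /= xy _.
      by case: (leP (qform D e1 e2 v1 v2 x y) 0) => h; [left|right].
    by case=> [/(cut_shadow D2)//|[]]; rewrite sE.
  by apply/seteqP; split => -[x y] //= [[_ /=]]; rewrite leNgt => /negP h [_ /h].
have ks := area_kept_ge s04 D2 ev q1 q2.
have cs := area_cone_le s04.
rewrite /sector_bound; move: split_cone; rewrite sE => /=.
set X := area (cone _ _) in cs *; set Y := area (cut _ _ _ _ _).
set Z := area (_ `&` _) in ks *.
have X0 : (0 <= X)%E by exact: measure_ge0.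
have Y0 : (0 <= Y)%E by exact: measure_ge0.
have Z0 : (0 <= Z)%E by exact: measure_ge0.
move: X Y Z X0 Y0 Z0 ks cs => [x| |] [y| |] [z| |] //=; rewrite ?lee_fin.
move=> x0 y0 z0 ks cs; rewrite -EFinD => -[xE].
rewrite -?EFinM ?lee_fin.
have hd0 : 0 <= hexdensity :> R.
  by rewrite /hexdensity divr_ge0 ?mulr_ge0 ?sqrtr_ge0 ?pi_ge0.
have : hexdensity * x <= hexdensity * (rho ^+ 2 * s) by rewrite ler_wpM2l.
lra.
Qed.

(** Two directions in which the parabola comes closer than rho make an acute
    angle. *)
Lemma acute_directions D e1 e2 v1 v2 (x y x' y' : R) : 2 <= D ->
    bessel e1 e2 v1 v2 ->
    x ^+ 2 + y ^+ 2 = rho ^+ 2 -> x' ^+ 2 + y' ^+ 2 = rho ^+ 2 ->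
    qform D e1 e2 v1 v2 x y <= 0 -> qform D e1 e2 v1 v2 x' y' <= 0 ->
  0 < x * x' + y * y'.
Proof.
move=> D2 ev xy xy' q q'.
have r0 := @rho_gt0 R; have r2 := @sqr_rho R.
have r76 : rho < 7 / 6 :> R.
  rewrite ltNge; apply/negP => h.
  have : 0 <= (rho - 7 / 6) * (rho + 7 / 6) :> R by rewrite mulr_ge0//; lra.
  lra.
have := qform_le0_dot (D := D) ev (ltW r0); move=> /[dup].
move=> /(_ x y); rewrite xy lexx => /(_ isT q) a1.
move=> /(_ x' y'); rewrite xy' lexx => /(_ isT q') a2.
have := ev (x + x') (y + y').
have -> : e1 * (x + x') + e2 * (y + y') = (e1 * x + e2 * y) + (e1 * x' + e2 * y') by ring.
have -> : (x + x') ^+ 2 + (y + y') ^+ 2 =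
  (x ^+ 2 + y ^+ 2) + (x' ^+ 2 + y' ^+ 2) + 2 * (x * x' + y * y') by ring.
rewrite xy xy' r2; set a := e1 * x + e2 * y in a1 *.
set a' := e1 * x' + e2 * y' in a2 *; set t := x * x' + y * y'.
have := sqr_ge0 (v1 * (x + x') + v2 * (y + y')) => b0 h.
have : 0 <= (a + a' - 2 * (2 - rho)) * (a + a' + 2 * (2 - rho)).
  by rewrite mulr_ge0//; lra.
have : (2 * (2 - rho)) ^+ 2 = 16 - 16 * rho + 4 * rho ^+ 2 :> R by ring.
rewrite r2; lra.
Qed.

Lemma pi_ge3 : 3 <= pi :> R.
Proof.
have p0 := pi_gt0 R; have p6 : 0 < pi / 6 :> R by rewrite divr_gt0.
have [c _] := @MVT R sin cos 0 (pi / 6) p6 (fun x _ => is_derive_sin x)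
  (continuous_subspaceT (@continuous_sin R)).
rewrite sin0 sin_pi6 !subr0 => e.
have : cos c * (pi / 6) <= pi / 6 by rewrite ler_piMl ?(ltW p6)// cos_le1.
by rewrite -e; lra.
Qed.

(** The unit disc is smaller than the hexagon circumscribed to it; in terms of
    the half-angle of a side, tan (pi / 6) >= pi / 6. *)
Lemma pi_le_sqrt12 : pi <= 2 * Num.sqrt 3 :> R.
Proof.
have p0 := pi_gt0 R; have p6 : 0 < pi / 6 :> R by rewrite divr_gt0.
have d (x : R) : is_derive x 1 (fun x : R => sin x - x * cos x) (x * sin x).
  by apply: is_derive_eq; rewrite /GRing.scale /=; ring.
have [c] := @MVT R _ _ 0 (pi / 6) p6 (fun x _ => d x)
  (continuous_subspaceT (fun x => is_derive_continuous (d x))).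
rewrite in_itv/= => /andP[c0 c6].
rewrite sin0 sin_pi6 cos_pi6 mul0r !subr0 => e.
have s0 : 0 < sin c by apply: sin_gt0_pihalf; rewrite c0/=; lra.
have : 0 < c * sin c * (pi / 6) by rewrite !mulr_gt0.
rewrite -e; have s3 := sqrt3_gt0 (R := R); have s32 := sqr_sqrt3 (R := R) => h.
clear d c c0 c6 e s0 p6; move: (pi : R) p0 h => P p0 h.
have : P * Num.sqrt 3 < 6 by lra.
have -> : 6 = 2 * Num.sqrt 3 * Num.sqrt 3 :> R.
  by rewrite -mulrA -expr2 s32; lra.
by rewrite ltr_pM2r// => /ltW.
Qed.

Lemma hexdensity_le1 : hexdensity <= 1 :> R.
Proof.
rewrite /hexdensity ler_pdivrMr ?mul1r ?mulr_gt0 ?pi_gt0//.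
have p3 := pi_ge3; have s3 := sqrt3_gt0 (R := R); have s32 := sqr_sqrt3 (R := R).
have : Num.sqrt 3 <= 2 :> R.
  rewrite leNgt; apply/negP => h.
  have : 0 < (Num.sqrt 3 - 2) * (Num.sqrt 3 + 2) :> R by rewrite mulr_gt0//; lra.
  lra.
lra.
Qed.

(** A direction of the shadow is first turned to the horizontal axis. On each
    side of it the parabola meets the circle at less than a right angle, since
    directions of the shadow make acute angles; turning the bisector of the
    two intersections to the horizontal axis makes the chord vertical. *)
Lemma planar_sector_bound D e1 e2 v1 v2 : 2 <= D -> bessel e1 e2 v1 v2 ->
  sector_bound D e1 e2 v1 v2.
Proof.
move=> D2 ev; have r0 := @rho_gt0 R; have pi0 := pi_gt0 R.
have [cut0|/set0P[[x0 y0] p0]] := eqVneq (cut D e1 e2 v1 v2) set0.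
  rewrite /sector_bound cut0 measure0 mule_ge0// lee_fin subr_ge0.
  exact: hexdensity_le1.
have [_ /= sf] := cut_shadow D2 p0.
have n0 := shadow_form_norm2 sf.
move: sf; rewrite shadow_form_gt0// => q0.
pose c := x0 / norm2 x0 y0; pose s := y0 / norm2 x0 y0.
have cs : c ^+ 2 + s ^+ 2 = 1.
  by rewrite !expr_div_n -mulrDl -sqr_norm2 divff// expf_neq0// gt_eqF.
rewrite /sector_bound (area_cut_rotation _ _ _ _ _ cs).
rewrite (area_shadow_rotation _ _ _ _ _ cs).
have := bessel_rotation cs ev.
have q0' : qform D (c * e1 + s * e2) (c * e2 - s * e1) (c * v1 + s * v2)
    (c * v2 - s * v1) rho 0 < 0.
  rewrite -qform_rotation; move: q0.
  rewrite (_ : rho / norm2 x0 y0 * x0 = c * rho - s * 0); last by rewrite /c; ring.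
  by rewrite (_ : rho / norm2 x0 y0 * y0 = s * rho + c * 0); last by rewrite /s; ring.
move: (c * e1 + s * e2) (c * e2 - s * e1) (c * v1 + s * v2) (c * v2 - s * v1) q0'.
clear - D2 r0 pi0 => e1 e2 v1 v2 q0 ev.
pose f (x : R) := qform D e1 e2 v1 v2 (rho * cos x) (rho * sin x).
have circ (x : R) : (rho * cos x) ^+ 2 + (rho * sin x) ^+ 2 = rho ^+ 2.
  transitivity (rho ^+ 2 * (cos x ^+ 2 + sin x ^+ 2)); first by ring.
  by rewrite cos2Dsin2 mulr1.
have f0 : f 0 < 0 by rewrite /f cos0 sin0 mulr1 mulr0.
have cf (a b : R) : {within `[a, b], continuous f}.
  apply: continuous_subspaceT => x.
  have cc : (fun x : R => rho * cos x) @ x --> rho * cos x.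
    by apply: cvgM; [exact: cvg_cst|exact: continuous_cos].
  have css : (fun x : R => rho * sin x) @ x --> rho * sin x.
    by apply: cvgM; [exact: cvg_cst|exact: continuous_sin].
  apply: cvgB; first apply: cvgB; first exact: cvg_cst.
    apply: cvgM; first exact: cvg_cst.
    by apply: cvgD; apply: cvgM => //; exact: cvg_cst.
  rewrite expr2; under eq_fun do rewrite expr2.
  by apply: cvgM; apply: cvgD; apply: cvgM => //; exact: cvg_cst.
have fpi (x : R) : cos x = 0 -> 0 <= f x.
  move=> cx; rewrite leNgt; apply/negP => fx.
  have := acute_directions D2 ev (circ 0) (circ x) (ltW f0) (ltW fx).
  by rewrite cx sin0 !mulr0 mul0r addr0 ltxx.
have [b] : exists2 b, b \in `[0, pi / 2] & f b = 0.
  apply: IVT => //; first by lra.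
  have fb := fpi (pi / 2) (cos_pihalf R).
  by rewrite min_l ?max_r ?(ltW f0)//= (le_trans (ltW f0)).
rewrite in_itv/= => /andP[b0 b2] fb.
have [a] : exists2 a, a \in `[- (pi / 2), 0] & f a = 0.
  apply: IVT => //; first by lra.
  have fa : 0 <= f (- (pi / 2)) by apply: fpi; rewrite cosN cos_pihalf.
  by rewrite min_r ?max_l ?(ltW f0)//= (le_trans (ltW f0)).
rewrite in_itv/= => /andP[a2 a0] fa.
have ab : a < b.
  rewrite lt_neqAle (le_trans a0 b0) andbT; apply/eqP => ab.
  have a00 : a = 0 by apply/eqP; rewrite eq_le a0 ab b0.
  by move: fa f0; rewrite a00 => ->; rewrite ltxx.
have cab : 0 < cos (b - a).
  have := acute_directions D2 ev (circ a) (circ b).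
  rewrite -/(f a) -/(f b) fa fb lexx => /(_ isT isT).
  rewrite (_ : _ + _ = rho ^+ 2 * cos (b - a)); last by rewrite cosB; ring.
  by rewrite pmulr_rgt0// exprn_gt0.
have ba2 : b - a < pi / 2.
  rewrite ltNge; apply/negP => h.
  have : cos (b - a) <= cos (pi / 2).
    by rewrite leNgt ltr_cos ?in_itv/= -?leNgt//; lra.
  by rewrite cos_pihalf leNgt cab.
pose mu := (a + b) / 2; pose sg := (b - a) / 2.
have cmu := cos2Dsin2 mu.
rewrite (area_cut_rotation _ _ _ _ _ cmu) (area_shadow_rotation _ _ _ _ _ cmu).
apply: (@chord_sector_bound sg) => //.
- by rewrite /sg; lra.
- exact: bessel_rotation.
- rewrite -qform_rotation -[RHS]fb /f.
  have -> : b = mu + sg by rewrite /mu /sg; field.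
  by rewrite cosD sinD; congr qform; ring.
- rewrite -qform_rotation -[RHS]fa /f.
  have -> : a = mu - sg by rewrite /mu /sg; field.
  by rewrite cosB sinB; congr qform; ring.
Qed.

End sector_bound.


(** * Points, lines and segments in space *)

Section euclid.
Context {R : realType}.
Implicit Types x y a v : 'rV[R]_3.

Lemma enormE x : enorm x = Num.sqrt (dot x x).
Proof. by congr Num.sqrt; apply: eq_bigr => i _; rewrite expr2. Qed.

Lemma sqr_enorm x : enorm x ^+ 2 = dot x x.
Proof. by rewrite enormE sqr_sqrtr// dot_ge0. Qed.

Lemma enorm_ge0 x : 0 <= enorm x.
Proof. exact: sqrtr_ge0. Qed.

Lemma enormN x : enorm (- x) = enorm x.
Proof. by rewrite !enormE !linE; congr Num.sqrt; ring. Qed.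

Lemma enormB x y : enorm (x - y) = enorm (y - x).
Proof. by rewrite -enormN opprB. Qed.

Lemma cauchy_schwarz x y : dot x y <= enorm x * enorm y.
Proof.
have [h|h] := leP (dot x y) 0.
  by rewrite (le_trans h)// mulr_ge0// enorm_ge0.
rewrite -ler_sqr ?nnegrE ?mulr_ge0 ?enorm_ge0 ?(ltW h)//.
rewrite exprMn !sqr_enorm -subr_ge0 !dotE.
set x0 := x ord0 ord0; set x1 := x ord0 1; set x2 := x ord0 2%R.
set y0 := y ord0 ord0; set y1 := y ord0 1; set y2 := y ord0 2%R.
have -> : (x0 * x0 + x1 * x1 + x2 * x2) * (y0 * y0 + y1 * y1 + y2 * y2) -
  (x0 * y0 + x1 * y1 + x2 * y2) ^+ 2 = (x0 * y1 - x1 * y0) ^+ 2 +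
  (x0 * y2 - x2 * y0) ^+ 2 + (x1 * y2 - x2 * y1) ^+ 2 by ring.
by rewrite !addr_ge0 ?sqr_ge0.
Qed.

Lemma enormD x y : enorm (x + y) <= enorm x + enorm y.
Proof.
rewrite -ler_sqr ?nnegrE ?addr_ge0 ?enorm_ge0// sqr_enorm.
have -> : (enorm x + enorm y) ^+ 2 =
  enorm x ^+ 2 + enorm y ^+ 2 + 2 * (enorm x * enorm y) by ring.
rewrite !sqr_enorm !linE (dotC y x); have := cauchy_schwarz x y; lra.
Qed.

Lemma enorm_dist x y z : enorm (x - z) <= enorm (x - y) + enorm (y - z).
Proof. by rewrite (le_trans _ (enormD _ _))// addrA subrK. Qed.

Lemma enorm_le x r : 0 <= r -> (enorm x <= r) = (dot x x <= r ^+ 2).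
Proof. by move=> r0; rewrite -sqr_enorm ler_sqr ?nnegrE ?enorm_ge0. Qed.

Lemma enorm_lt x r : 0 <= r -> (enorm x < r) = (dot x x < r ^+ 2).
Proof. by move=> r0; rewrite -sqr_enorm ltr_sqr ?nnegrE ?enorm_ge0. Qed.

(** Three points at mutual distances at least 2 do not lie in a ball of radius
    rho with one of them inside: the sum of the squared distances is at most
    three times the moment of inertia, 3 * 3 * rho ^ 2 = 12. *)
Lemma no_three_points x y z :
  enorm x <= rho -> enorm y <= rho -> enorm z < rho ->
  2 <= enorm (x - y) -> 2 <= enorm (y - z) -> 2 <= enorm (z - x) -> False.
Proof.
have r0 := @rho_gt0 R; have r2 := @sqr_rho R.
have d2 u v : 2 <= enorm (u - v) -> 4 <= dot (u - v) (u - v) :> R.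
  rewrite -sqr_enorm => h; rewrite (_ : 4 = 2 ^+ 2); last by ring.
  by rewrite ler_sqr ?nnegrE ?enorm_ge0.
rewrite !enorm_le ?enorm_lt ?(ltW r0)// => hx hy hz /d2 xy /d2 yz /d2 zx.
have := dot_ge0 (x + y + z).
move: xy yz zx; rewrite !linE (dotC y x) (dotC z x) (dotC z y); lra.
Qed.

Lemma sqr_enorm_plane x f1 f2 (y z : R) :
  dot f1 f1 = 1 -> dot f2 f2 = 1 -> dot f1 f2 = 0 ->
  enorm (x + y *: f1 + z *: f2 - x) ^+ 2 = y ^+ 2 + z ^+ 2.
Proof.
move=> f11 f22 f12; rewrite sqr_enorm addrAC (addrAC x) subrr add0r.
by rewrite !linE f11 f22 f12 (dotC f2 f1) f12; ring.
Qed.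

Lemma bessel2 f1 f2 x : dot f1 f1 = 1 -> dot f2 f2 = 1 -> dot f1 f2 = 0 ->
  dot x f1 ^+ 2 + dot x f2 ^+ 2 <= dot x x.
Proof.
move=> h1 h2 h12.
have := dot_ge0 (x - dot x f1 *: f1 - dot x f2 *: f2).
rewrite !linE h1 h2 h12 (dotC f2 f1) h12 (dotC f1 x) (dotC f2 x); lra.
Qed.

Definition height a v x : R := dot (x - a) v.

(** For a unit vector v, the squared distance from x to the line through a with
    direction v. *)
Definition dline a v x : R := dot (x - a) (x - a) - height a v x ^+ 2.

(** The squared distance from x to the segment of length t on this line that
    starts at a: by Pythagoras, the overshoot of the projection adds its
    square. *)
Definition dseg (t : R) a v x : R :=
  dline a v x + (height a v x - clamp t (height a v x)) ^+ 2.

Lemma clamp_in (t k : R) : 0 <= t -> 0 <= clamp t k <= t.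
Proof.
move=> t0; rewrite /clamp le_max lexx ge_max t0 ge_min lexx orbT//.
Qed.

Lemma clamp_id (t k : R) : 0 <= k <= t -> clamp t k = k.
Proof. by move=> /andP[k0 kt]; rewrite /clamp min_l// max_r. Qed.

Lemma clamp_nearest (t k s : R) : 0 <= s <= t ->
  (k - clamp t k) ^+ 2 <= (k - s) ^+ 2.
Proof.
move=> /andP[s0 st]; have [k0|k0] := leP k 0.
  rewrite /clamp min_l ?max_l//; last by lra.
  nra.
have [tk|tk] := leP t k; last first.
  by rewrite clamp_id ?subrr ?expr0n/= ?sqr_ge0// !ltW.
rewrite /clamp min_r// max_r; last by lra.
nra.
Qed.

Variables (t : R) (a v : 'rV[R]_3).
Hypotheses (t0 : 0 <= t) (v1 : dot v v = 1).

Lemma dist_line_pt x s : dot (x - (a + s *: v)) (x - (a + s *: v)) =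
  dline a v x + (height a v x - s) ^+ 2.
Proof.
rewrite /dline /height !linE v1 (dotC v x) (dotC v a) (dotC a x); ring.
Qed.

Lemma dlineE x : dline a v x = dot (x - (a + height a v x *: v)) (x - (a + height a v x *: v)).
Proof. by rewrite dist_line_pt subrr expr0n addr0. Qed.

Lemma dline_le x : dline a v x <= dseg t a v x.
Proof. by rewrite lerDl sqr_ge0. Qed.

Lemma dseg_le x s : 0 <= s <= t ->
  dseg t a v x <= dot (x - (a + s *: v)) (x - (a + s *: v)).
Proof. by move=> st; rewrite dist_line_pt lerD2l clamp_nearest. Qed.

Lemma dseg_attained x : exists2 s, 0 <= s <= t &
  dseg t a v x = dot (x - (a + s *: v)) (x - (a + s *: v)).
Proof.
exists (clamp t (height a v x)); first exact: clamp_in.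
by rewrite dist_line_pt.
Qed.

Lemma dseg_ge0 x : 0 <= dseg t a v x.
Proof. by have [s _ ->] := dseg_attained x; exact: dot_ge0. Qed.

Lemma dsegE x : 0 <= height a v x <= t -> dseg t a v x = dline a v x.
Proof. by move=> h; rewrite /dseg clamp_id// subrr expr0n addr0. Qed.

End euclid.


(** * Normal slices of a truncated Dirichlet cell *)

Section finite_unions.
Context d (T : measurableType d) (R : realType) (m : {measure set T -> \bar R}).

Lemma bigsetU_ordP n (F : 'I_n -> set T) x :
  (\big[setU/set0]_(i < n) F i) x <-> exists i, F i x.
Proof.
rewrite -bigcup_seq; split => [[i _ Fi]|[i Fi]]; first by exists i.
by exists i => //=; rewrite mem_index_enum.
Qed.

Lemma measurable_bigsetU_ord n (F : 'I_n -> set T) :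
  (forall i, measurable (F i)) -> measurable (\big[setU/set0]_(i < n) F i).
Proof. by move=> mF; apply: bigsetU_measurable. Qed.

Lemma measure_bigsetU_ord_le n (F : 'I_n -> set T) :
  (forall i, measurable (F i)) ->
  (m (\big[setU/set0]_(i < n) F i) <= \sum_(i < n) m (F i))%E.
Proof.
move=> mF.
suff [] : measurable (\big[setU/set0]_(i < n) F i) /\
  (m (\big[setU/set0]_(i < n) F i) <= \sum_(i < n) m (F i))%E by [].
elim/big_rec2 : _ => [|i y A _ [mA Ay]]; first by rewrite measure0.
split; first exact: measurableU.
by rewrite (le_trans (measureU2 _ _ _))// leeD2l.
Qed.

Lemma measurable_forall_ord n (F : 'I_n -> set T) :
  (forall i, measurable (F i)) -> measurable [set x | forall i, F i x].
Proof.
move=> mF.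
have -> : [set x | forall i, F i x] = ~` \big[setU/set0]_(i < n) (~` F i).
  apply/seteqP; split => x /=.
    by move=> Fx /bigsetU_ordP[i]; apply; exact: Fx.
  move=> h i; apply: contrapT => Fi; apply: h; apply/bigsetU_ordP.
  by exists i.
by apply/measurableC/measurable_bigsetU_ord => i; exact: measurableC.
Qed.

End finite_unions.

Section slice.
Context {R : realType}.
Notation T1 := (measurableTypeR R).

Section one_neighbour.
Variables (t : R) (a v x f1 f2 : 'rV[R]_3).
Hypotheses (t0 : 0 <= t) (vv : dot v v = 1).
Hypotheses (f11 : dot f1 f1 = 1) (f22 : dot f2 f2 = 1) (f12 : dot f1 f2 = 0).
Hypothesis near_axis : forall s, 0 <= s <= t -> 2 <= enorm (x - (a + s *: v)).
Hypothesis far_ends : 2 * rho <= enorm (x - a) /\ 2 * rho <= enorm (x - (a + t *: v)).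

Let P (y z : R) := x + y *: f1 + z *: f2.

Let P_dist y z : enorm (P y z - x) ^+ 2 = y ^+ 2 + z ^+ 2.
Proof. exact: sqr_enorm_plane. Qed.

Let k := height a v x.
Let foot := a + k *: v.
Let D := enorm (x - foot).

Let dist_axis s : enorm (x - (a + s *: v)) ^+ 2 = D ^+ 2 + (k - s) ^+ 2.
Proof. by rewrite !sqr_enorm -/k dist_line_pt// dlineE. Qed.

Let e := D^-1 *: (foot - x).

Let dline_plane y z : 0 < D -> dline a v (P y z) =
  y ^+ 2 + z ^+ 2 + qform D (dot e f1) (dot e f2) (dot v f1) (dot v f2) y z.
Proof.
move=> D0.
have D2 : D ^+ 2 = dot (x - a) (x - a) - k ^+ 2.
  by rewrite sqr_enorm -dlineE.
have De u : D * dot e u = dot (foot - x) u.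
  by rewrite /e dotZl mulrA divff ?gt_eqF// mul1r.
have -> : qform D (dot e f1) (dot e f2) (dot v f1) (dot v f2) y z =
  D ^+ 2 - 2 * (y * (D * dot e f1) + z * (D * dot e f2)) -
  (dot v f1 * y + dot v f2 * z) ^+ 2 by rewrite /qform; ring.
rewrite !De D2 /dline /height.
have hk : dot (P y z - a) v = k + (dot v f1 * y + dot v f2 * z).
  by rewrite /P /k /height !linE (dotC v f1) (dotC v f2); ring.
rewrite hk /foot /P !linE f11 f22 f12 (dotC f2 f1) f12.
rewrite (dotC f1 a) (dotC f2 a) (dotC f1 x) (dotC f2 x) (dotC a x).
ring.
Qed.

Let De_v : 0 < D -> dot e v = 0.
Proof.
move=> D0; rewrite /e /foot /k /height !linE vv; ring.
Qed.

Let ee : 0 < D -> dot e e = 1.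
Proof.
move=> D0; rewrite /e !dotZl !dotZr -sqr_enorm enormB -/D.
by field; rewrite gt_eqF.
Qed.

Let bessel_frame : 0 < D -> bessel (dot e f1) (dot e f2) (dot v f1) (dot v f2).
Proof.
move=> D0 y z.
move: (ee D0) (De_v D0); move: e => e' ee' ev'.
have := @bessel2 R e' v (y *: f1 + z *: f2) ee' vv ev'.
rewrite !linE f11 f22 f12 (dotC f2 f1) f12 (dotC f1 e') (dotC f2 e') (dotC f1 v) (dotC f2 v).
by move=> h; lra.
Qed.

(** The part of the disc of radius rho that is closer to a neighbouring segment
    than to the axis, and its shadow on the circle: directions in which the
    neighbour comes closer than rho. *)
Lemma neighbour_shadow : exists K S : set (T1 * T1),
  [/\ measurable K /\ measurable S,
   (area K <= (1 - hexdensity)%:E * area S)%E,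
   S `<=` [set q | (q.1 : R) ^+ 2 + (q.2 : R) ^+ 2 < rho ^+ 2],
   forall y z, y ^+ 2 + z ^+ 2 < rho ^+ 2 ->
     dseg t a v (x + y *: f1 + z *: f2) <= y ^+ 2 + z ^+ 2 -> K (y, z) &
   forall y z, S (y, z) -> 0 < norm2 y z /\
     dseg t a v (x + (rho / norm2 y z * y) *: f1 + (rho / norm2 y z * z) *: f2)
       < rho ^+ 2].
Proof.
have r0 := @rho_gt0 R.
have [far0 fart] : 4 * rho ^+ 2 <= D ^+ 2 + k ^+ 2 /\
    4 * rho ^+ 2 <= D ^+ 2 + (k - t) ^+ 2.
  have [h0 ht] := far_ends.
  have sq (u : 'rV[R]_3) : 2 * rho <= enorm u -> 4 * rho ^+ 2 <= enorm u ^+ 2.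
    move=> h; rewrite (_ : 4 * _ = (2 * rho) ^+ 2); last by ring.
    by rewrite ler_sqr ?nnegrE ?enorm_ge0// mulr_ge0// ltW.
  have := sq _ h0; have := sq _ ht; rewrite dist_axis => ht' h0'; split => //.
  by move: (dist_axis 0); rewrite scale0r addr0 subr0 => E; rewrite -E.
(* If the foot of the perpendicular from x misses the segment, the end that
   is nearest to the foot keeps the whole segment at distance 2 rho from x. *)
have [kt|kt] := boolP (0 <= k <= t); last first.
  exists set0, set0; split => //; first by rewrite !measure0 mule0.
  move=> y z yz; have [s st ->] := @dseg_attained R t a v t0 vv (P y z).
  rewrite leNgt -(P_dist) -sqr_enorm => /negP h.
  have d2 : 2 * rho <= enorm (x - (a + s *: v)).
    rewrite -ler_sqr ?nnegrE ?enorm_ge0//; last by rewrite mulr_ge0// ltW.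
    rewrite dist_axis (_ : (2 * rho) ^+ 2 = 4 * rho ^+ 2); last by ring.
    move: kt st; rewrite negb_and -!ltNge => /orP[] hk /andP[s0 st].
      apply: (le_trans far0); rewrite lerD2l; nra.
    apply: (le_trans fart); rewrite lerD2l; nra.
  have d1 : enorm (P y z - x) < rho.
    by rewrite -ltr_sqr ?nnegrE ?enorm_ge0 ?(ltW r0)// P_dist.
  case: h; rewrite ltr_sqr ?nnegrE ?enorm_ge0//.
  have := enorm_dist x (P y z) (a + s *: v); rewrite (enormB x (P y z)); lra.
have D2 : 2 <= D by exact: near_axis.
have D0 : 0 < D by lra.
exists (cut D (dot e f1) (dot e f2) (dot v f1) (dot v f2)).
exists (shadow D (dot e f1) (dot e f2) (dot v f1) (dot v f2)).
split.
- by split; [exact: measurable_cut|exact: measurable_shadow].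
- exact: (planar_sector_bound D2 (bessel_frame D0)).
- by move=> q [].
- move=> y z yz h; split => //=.
  have := le_trans (dline_le t a v (P y z)) h; rewrite dline_plane//; lra.
- move=> y z [_ /= sf]; have n0 := shadow_form_norm2 sf.
  split => //; move: sf; rewrite shadow_form_gt0//.
  have := circle_norm2 n0; set y' := _ / _ * y; set z' := _ / _ * z => circ q0.
  rewrite -/(P y' z').
  have dl : dline a v (P y' z') < rho ^+ 2 by rewrite dline_plane// circ; lra.
  suff hk : 0 <= height a v (P y' z') <= t by rewrite dsegE.
  set s := height a v (P y' z').
  have d2 : D ^+ 2 + (k - s) ^+ 2 < 4 * rho ^+ 2.
    rewrite -dist_axis (_ : 4 * _ = (2 * rho) ^+ 2); last by ring.
    rewrite ltr_sqr ?nnegrE ?enorm_ge0//; last by rewrite mulr_ge0// ltW.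
    apply: (le_lt_trans (enorm_dist _ (P y' z') _)).
    have -> : 2 * rho = rho + rho :> R by ring.
    apply: ler_ltD.
      by rewrite enormB -ler_sqr ?nnegrE ?enorm_ge0 ?(ltW r0)// P_dist circ.
    by rewrite -ltr_sqr ?nnegrE ?enorm_ge0 ?(ltW r0)// sqr_enorm -dlineE.
  move: kt => /andP[k0 kt].
  rewrite leNgt (leNgt s t); apply/andP; split; apply/negP => hs; nra.
Qed.

End one_neighbour.

End slice.


Section family.
Context {R : realType}.
Notation T1 := (measurableTypeR R).
Variables (n : nat) (t : R) (A V : 'I_n -> 'rV[R]_3).
Hypotheses (t0 : 0 <= t) (VV : forall i, dot (V i) (V i) = 1).

Definition axis_pt i (s : R) := A i + s *: V i.

Definition separated := forall i j s s', i != j -> 0 <= s <= t -> 0 <= s' <= t ->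
  2 <= enorm (axis_pt i s - axis_pt j s').

Hypothesis sep : separated.

(** This condition makes the segments that come within rho of points of the
    truncated normal slice look like complete lines from there. *)
Definition far_from_ends i z := forall j,
  2 * rho <= enorm (axis_pt i z - A j) /\ 2 * rho <= enorm (axis_pt i z - axis_pt j t).

Definition slice_cell i (x f1 f2 : 'rV[R]_3) : set (T1 * T1) := [set q |
  (q.1 : R) ^+ 2 + (q.2 : R) ^+ 2 < rho ^+ 2 /\
  forall j, j != i -> (q.1 : R) ^+ 2 + (q.2 : R) ^+ 2 <
    dseg t (A j) (V j) (x + (q.1 : R) *: f1 + (q.2 : R) *: f2)].

Lemma area_disc_rho :
  area [set q : T1 * T1 | (q.1 : R) ^+ 2 + (q.2 : R) ^+ 2 < rho ^+ 2] =
  (pi * (4 / 3))%:E.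
Proof. by rewrite area_disc_lt sqr_rho max_r// divr_ge0. Qed.

(** Shadows of distinct neighbours are disjoint, as at a common direction
    three axes would come within rho of one point of the circle; so the
    bounds for the single neighbours add up. *)
Lemma slice_area_ge i z f1 f2 : 0 <= z <= t -> far_from_ends i z ->
    dot f1 f1 = 1 -> dot f2 f2 = 1 -> dot f1 f2 = 0 ->
    measurable (slice_cell i (axis_pt i z) f1 f2) ->
  ((2 * Num.sqrt 3)%:E <= area (slice_cell i (axis_pt i z) f1 f2))%E.
Proof.
move=> zt far f11 f22 f12; set x := axis_pt i z; set B := slice_cell _ _ _ _ => mB.
have r0 := @rho_gt0 R; have pi0 := pi_gt0 R.
pose P (y z : R) := x + y *: f1 + z *: f2.
have Pd (y z' : R) : enorm (P y z' - x) ^+ 2 = y ^+ 2 + z' ^+ 2.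
  exact: sqr_enorm_plane.
have /choice[KS KSP] : forall j, exists KS : set (T1 * T1) * set (T1 * T1),
    [/\ measurable KS.1 /\ measurable KS.2,
     (area KS.1 <= (1 - hexdensity)%:E * area KS.2)%E,
     KS.2 `<=` [set q | (q.1 : R) ^+ 2 + (q.2 : R) ^+ 2 < rho ^+ 2],
     j != i -> forall y z, y ^+ 2 + z ^+ 2 < rho ^+ 2 ->
       dseg t (A j) (V j) (P y z) <= y ^+ 2 + z ^+ 2 -> KS.1 (y, z) &
     forall y z, KS.2 (y, z) -> [/\ j != i, 0 < norm2 y z &
       dseg t (A j) (V j) (P (rho / norm2 y z * y) (rho / norm2 y z * z)) < rho ^+ 2]].
  move=> j; have [->|ji] := eqVneq j i.
    exists (set0, set0); split => //=; first by rewrite !measure0 mule0.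
  have near s : 0 <= s <= t -> 2 <= enorm (x - (A j + s *: V j)).
    by move=> st; apply: sep; rewrite // eq_sym.
  have [K [S [mKS KS SD DK SP]]] :=
    neighbour_shadow t0 (VV j) f11 f22 f12 near (far j).
  exists (K, S); split => //= y z' /SP[]; split => //.
pose K j := (KS j).1; pose S j := (KS j).2.
have mK j : measurable (K j) by have [[]] := KSP j.
have mS j : measurable (S j) by have [[]] := KSP j.
have KSle j : (area (K j) <= (1 - hexdensity)%:E * area (S j))%E by have [] := KSP j.
have tS : trivIset setT S.
  apply/trivIsetP => j l _ _ jl; rewrite -subset0 => -[y z'] [Sj Sl].
  have [_ _ _ _ /(_ _ _ Sj)[ji n0 dj]] := KSP j.
  have [_ _ _ _ /(_ _ _ Sl)[li _ dl]] := KSP l.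
  have circ := circle_norm2 n0.
  move: dj dl circ; set y' := _ * y; set w' := _ * z' => dj dl circ.
  have [sj sjt djE] := @dseg_attained R t (A j) (V j) t0 (VV j) (P y' w').
  have [sl slt dlE] := @dseg_attained R t (A l) (V l) t0 (VV l) (P y' w').
  apply: (@no_three_points R (x - P y' w') (axis_pt j sj - P y' w')
    (axis_pt l sl - P y' w')).
  - by rewrite enormB -ler_sqr ?nnegrE ?enorm_ge0 ?(ltW r0)// Pd circ.
  - rewrite enormB -ler_sqr ?nnegrE ?enorm_ge0 ?(ltW r0)// sqr_enorm -djE.
    exact: ltW.
  - by rewrite enormB -ltr_sqr ?nnegrE ?enorm_ge0 ?(ltW r0)// sqr_enorm -dlE.
  - by rewrite opprB addrA subrK; apply: sep; rewrite // eq_sym.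
  - by rewrite opprB addrA subrK; apply: sep.
  - by rewrite opprB addrA subrK; apply: sep.
pose disc : set (T1 * T1) := [set q | (q.1 : R) ^+ 2 + (q.2 : R) ^+ 2 < rho ^+ 2].
have mdisc : measurable disc by exact: measurable_open_disc.
have cover : disc `<=` B `|` \big[setU/set0]_(j < n) K j.
  move=> [y z'] yz; have [h|h] := pselect (exists j, K j (y, z')).
    by right; apply/bigsetU_ordP.
  left; split => //= j ji; rewrite ltNge; apply/negP => dj; apply: h; exists j.
  by have [_ _ _ DK _] := KSP j; exact: DK.
have mUK := measurable_bigsetU_ord mK.
have h1 : (area disc <= area B + \sum_(j < n) area (K j))%E.
  apply: (@le_trans _ _ (area (B `|` \big[setU/set0]_(j < n) K j))).
    by apply: le_measure; rewrite ?inE//; exact: measurableU.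
  apply: (le_trans (measureU2 _ mB mUK)).
  by rewrite leeD2l// measure_bigsetU_ord_le.
have h2 : (\sum_(j < n) area (S j) <= area disc)%E.
  rewrite -(@measure_bigsetU_ord _ _ _ area n xpredT S mS tS).
  apply: le_measure; rewrite ?inE//; first exact: measurable_bigsetU_ord.
  by move=> q /bigsetU_ordP[j]; have [_ _ SD _ _] := KSP j; exact: SD.
have hd := @hexdensity_le1 R.
have h3 : (\sum_(j < n) area (K j) <= (1 - hexdensity)%:E * area disc)%E.
  apply: (@le_trans _ _ (\sum_(j < n) ((1 - hexdensity)%:E * area (S j)))%E).
    by apply: lee_sum => j _; exact: KSle.
  rewrite -ge0_sume_distrr; last by move=> j _; exact: measure_ge0.
  by rewrite lee_wpmul2l// lee_fin subr_ge0.
have : (area disc <= area B + (1 - hexdensity)%:E * area disc)%E.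
  by rewrite (le_trans h1)// leeD2l.
rewrite area_disc_rho -EFinM.
have -> : 2 * Num.sqrt 3 = pi * (4 / 3) - (1 - hexdensity) * (pi * (4 / 3)) :> R.
  rewrite /hexdensity; move: (pi : R) (Num.sqrt 3 : R) pi0 => p q p0.
  by field; rewrite gt_eqF.
by rewrite EFinB leeBlDr.
Qed.

End family.


(** * Volumes of cells and lengths of axes *)

Section volumes.
Context {R : realType}.
Notation T1 := (measurableTypeR R).
Notation leb := (@lebesgue_measure R).
Notation space := (T1 * T1 * T1)%type.
Implicit Types (a v : 'rV[R]_3) (W : set 'rV[R]_3).

Definition measurable3 W := measurable (@vec3 R @^-1` W : set space).
Definition measurable_fun3 (g : 'rV[R]_3 -> R) :=
  measurable_fun setT ((fun p => g (vec3 p)) : space -> R).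

Let measurable_coordinates :
  measurable_fun setT (fun p : space => (p.1.1 : R)) /\
  measurable_fun setT (fun p : space => (p.1.2 : R)).
Proof.
have mfst := @measurable_fst _ _ (T1 * T1)%type T1.
split; first exact: (measurableT_comp (@measurable_fst _ _ T1 T1) mfst).
exact: (measurableT_comp (@measurable_snd _ _ T1 T1) mfst).
Qed.

Lemma measurable_fun3_dot v : measurable_fun3 (dot^~ v).
Proof.
rewrite /measurable_fun3; under eq_fun do rewrite dotE !mxE /=.
have [m1 m2] := measurable_coordinates.
by apply: measurable_funD; [apply: measurable_funD|]; apply: measurable_funM.
Qed.

Lemma measurable_fun3_sqr : measurable_fun3 (fun x => dot x x).
Proof.
rewrite /measurable_fun3; under eq_fun do rewrite dotE !mxE /=.
have [m1 m2] := measurable_coordinates.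
by apply: measurable_funD; [apply: measurable_funD|]; apply: measurable_funM.
Qed.

Lemma measurable_fun3_dist a : measurable_fun3 (fun x => dot (x - a) (x - a)).
Proof.
rewrite /measurable_fun3.
rewrite (_ : (fun _ => _) = (fun p => (dot (vec3 p) (vec3 p) - 2 * dot (vec3 p) a) + dot a a)).
  apply: measurable_funD => //; apply: measurable_funB.
    exact: measurable_fun3_sqr.
  by apply: measurable_funM => //; exact: measurable_fun3_dot.
by apply/funext => p; rewrite !linE (dotC a (vec3 p)); ring.
Qed.

Lemma measurable_fun3_height a v : measurable_fun3 (height a v).
Proof.
rewrite /measurable_fun3.
rewrite (_ : (fun _ => _) = (fun p => dot (vec3 p) v - dot a v)).
  by apply: measurable_funB => //; exact: measurable_fun3_dot.
by apply/funext => p; rewrite /height !linE.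
Qed.

Lemma measurable_fun3_dline a v : measurable_fun3 (dline a v).
Proof.
apply: measurable_funB; first exact: measurable_fun3_dist.
by apply: measurable_funX; exact: measurable_fun3_height.
Qed.

Lemma measurable_fun3_dseg t a v : measurable_fun3 (dseg t a v).
Proof.
have mh := measurable_fun3_height a v.
apply: measurable_funD; first exact: measurable_fun3_dline.
apply: measurable_funX; apply: measurable_funB; first exact: mh.
exact: (measurableT_comp (measurable_clamp t) mh).
Qed.

(** Passing to orthonormal coordinates along an axis is a Euclidean motion,
    which preserves volume. *)
Lemma vol_frame a v : dot v v = 1 -> exists f1 f2 : 'rV[R]_3,
  [/\ dot f1 f1 = 1, dot f2 f2 = 1, dot f1 f2 = 0 & dot f1 v = 0 /\ dot f2 v = 0] /\
  forall W, measurable3 W ->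
    measurable ([set p | W (a + (p.1.1 : R) *: f1 + (p.1.2 : R) *: f2 + (p.2 : R) *: v)] : set space) /\
    vol W = vol3 [set p : space | W (a + (p.1.1 : R) *: f1 + (p.1.2 : R) *: f2 + (p.2 : R) *: v)].
Proof.
move=> vv; have [f1 [f2 [on [G [mG pG] GE]]]] := exists_frame a vv.
exists f1, f2; split => // W mW.
have E : [set p : space | W (a + (p.1.1 : R) *: f1 + (p.1.2 : R) *: f2 + (p.2 : R) *: v)] =
    G @^-1` (@vec3 R @^-1` W).
  by apply/seteqP; split => -[[x y] z] /=; rewrite GE.
rewrite E; split; last by rewrite pG.
by rewrite -[X in measurable X]setTI; exact: mG.
Qed.

Section frame.
Variables (a v f1 f2 : 'rV[R]_3) (vv : dot v v = 1).
Hypotheses (f11 : dot f1 f1 = 1) (f22 : dot f2 f2 = 1) (f12 : dot f1 f2 = 0).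
Hypotheses (f1v : dot f1 v = 0) (f2v : dot f2 v = 0).
Variables x y z : R.
Let p := a + x *: f1 + y *: f2 + z *: v.

Let pa : p - a = x *: f1 + y *: f2 + z *: v.
Proof. by rewrite /p addrAC (addrAC (a + _)) (addrAC a) subrr add0r. Qed.

Lemma height_frame : height a v p = z.
Proof. by rewrite /height pa !linE f1v f2v vv; ring. Qed.

Lemma dist_frame : dot (p - a) (p - a) = x ^+ 2 + y ^+ 2 + z ^+ 2.
Proof.
rewrite pa !linE f11 f22 f12 (dotC f2 f1) f12 vv (dotC v f1) (dotC v f2) f1v f2v.
ring.
Qed.

Lemma dline_frame : dline a v p = x ^+ 2 + y ^+ 2.
Proof. by rewrite /dline dist_frame height_frame; ring. Qed.

Lemma dseg_frame t : dseg t a v p = x ^+ 2 + y ^+ 2 + (z - clamp t z) ^+ 2.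
Proof. by rewrite /dseg dline_frame height_frame. Qed.

End frame.

Let unit_vector : exists v : 'rV[R]_3, dot v v = 1.
Proof. by exists (vec3 (1, 0, 0)); rewrite dotE !mxE /=; ring. Qed.

Lemma clamp0 (z : R) : clamp 0 z = 0.
Proof. by rewrite /clamp max_l// ge_min lexx orbT. Qed.

Lemma measurable3_ball a r : measurable3 [set x | dot (x - a) (x - a) <= r].
Proof. by apply: measurable_set_le => //; exact: measurable_fun3_dist. Qed.

Lemma vol_ball a (r : R) : 0 < r ->
  vol [set x | enorm (x - a) <= r] = (pi * (4 / 3 * r ^+ 3))%:E.
Proof.
move=> r0; have [v vv] := unit_vector.
have [f1 [f2 [[f11 f22 f12 [f1v f2v]] FW]]] := vol_frame a vv.
have -> : [set x | enorm (x - a) <= r] = [set x | dot (x - a) (x - a) <= r ^+ 2].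
  by apply/seteqP; split => x /=; rewrite enorm_le// ltW.
have [_ ->] := FW _ (measurable3_ball a (r ^+ 2)).
have := @vol3_capsule_le R 0 r (lexx _) r0; rewrite mulr0 add0r => <-.
congr (vol3 _); apply/seteqP; split => -[[x y] z] /=;
  rewrite /capsule_le/= dist_frame// clamp0; lra.
Qed.

Lemma measurable3_capsule t a v (r : R) : measurable3 [set x | dseg t a v x <= r].
Proof. by apply: measurable_set_le => //; exact: measurable_fun3_dseg. Qed.

Lemma vol_capsule t a v : 0 <= t -> dot v v = 1 ->
  vol [set x | dseg t a v x <= 1] = (pi * (t + 4 / 3))%:E.
Proof.
move=> t0 vv.
have [f1 [f2 [[f11 f22 f12 [f1v f2v]] FW]]] := vol_frame a vv.
have [_ ->] := FW _ (measurable3_capsule t a v 1).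
have := @vol3_capsule_le R t 1 t0 ltr01; rewrite !expr1n mulr1 mul1r => <-.
congr (vol3 _); apply/seteqP; split => -[[x y] z] /=;
  rewrite /capsule_le/= dseg_frame// expr1n; lra.
Qed.

End volumes.


Section counting.
Context {R : realType}.
Notation T1 := (measurableTypeR R).
Notation leb := (@lebesgue_measure R).
Notation space := (T1 * T1 * T1)%type.
Variables (n : nat) (t : R) (A V : 'I_n -> 'rV[R]_3).
Hypotheses (tge0 : 0 <= t) (VV : forall i, dot (V i) (V i) = 1).
Hypothesis sep : separated t A V.
Local Notation pt := (axis_pt A V).

Lemma dseg_sum_ge i j x : i != j ->
  2 <= Num.sqrt (dseg t (A i) (V i) x) + Num.sqrt (dseg t (A j) (V j) x).
Proof.
move=> ij.
have [s st ->] := @dseg_attained R t (A i) (V i) tge0 (VV i) x.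
have [s' st' ->] := @dseg_attained R t (A j) (V j) tge0 (VV j) x.
rewrite -!enormE enormB; apply: le_trans (enorm_dist _ _ _).
exact: sep.
Qed.

Lemma dseg_lt1 i j x : i != j -> dseg t (A i) (V i) x < 1 ->
  1 < dseg t (A j) (V j) x.
Proof.
move=> ij; have := dseg_sum_ge x ij.
have := dseg_ge0 (A i) tge0 (VV i) x; have := dseg_ge0 (A j) tge0 (VV j) x.
set u := dseg _ (A i) _ _; set w := dseg _ (A j) _ _ => w0 u0 h u1.
have su : Num.sqrt u < 1 by rewrite -sqrtr1 ltr_sqrt.
have : 1 < Num.sqrt w by lra.
by move=> sw; rewrite -(sqr_sqrtr w0) exprn_egt1.
Qed.

(** The Dirichlet cell of the i-th axis, truncated at distance rho. *)
Definition cell i : set 'rV[R]_3 := [set x | dseg t (A i) (V i) x < rho ^+ 2 /\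
  forall j, j != i -> dseg t (A i) (V i) x < dseg t (A j) (V j) x].

Lemma measurable_cell i : measurable3 (cell i).
Proof.
apply: measurableI.
  by apply: measurable_set_lt => //; exact: measurable_fun3_dseg.
apply: (@measurable_forall_ord _ _ _ (fun j => @vec3 R @^-1` [set x |
   j != i -> dseg t (A i) (V i) x < dseg t (A j) (V j) x])) => j.
have [->|ji] := eqVneq j i.
  by rewrite (_ : _ @^-1` _ = setT)//; apply/seteqP; split => // x _ /=.
rewrite (_ : _ @^-1` _ = [set p | dseg t (A i) (V i) (vec3 p) < dseg t (A j) (V j) (vec3 p)]).
  by apply: measurable_set_lt; exact: measurable_fun3_dseg.
by apply/seteqP; split => p /=; [exact|move=> h _].
Qed.

Lemma trivIset_cell : trivIset setT cell.
Proof.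
apply/trivIsetP => i j _ _ ij; rewrite -subset0 => x [[_ hi] [_ hj]].
by have := hi j; rewrite eq_sym ij => /(_ isT); have := hj i ij; lra.
Qed.

Definition good i : set T1 := [set z : R | 0 <= z <= t /\ far_from_ends t A V i z].

Lemma measurable_near_end i e (r : R) :
  measurable ([set z : R | enorm (pt i z - e) < r] : set T1).
Proof.
apply: measurable_set_lt => //.
rewrite (_ : (fun z => _) = Num.sqrt \o (fun z : T1 =>
   \sum_(k < 3) (pt i z - e) ord0 k ^+ 2))//.
apply: measurableT_comp.
  by apply: continuous_measurable_fun; exact: sqrt_continuous.
apply: measurable_sum => k; apply: measurable_funX.
under eq_fun do rewrite !mxE.
apply: measurable_funB => //; apply: measurable_funD => //.
exact: measurable_funM.
Qed.

Lemma measurable_axis_range : measurable ([set z : R | 0 <= z <= t] : set T1).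
Proof.
by rewrite (_ : [set z | _] = `[0, t]%classic) // set_itvcc.
Qed.

Lemma measurable_good i : measurable (good i).
Proof.
apply: measurableI; first exact: measurable_axis_range.
apply: (@measurable_forall_ord _ _ _ (fun j => [set z : R |
   2 * rho <= enorm (pt i z - A j) /\
   2 * rho <= enorm (pt i z - pt j t)])) => j.
rewrite (_ : [set z | _] = ~` ([set z : R | enorm (pt i z - A j) < 2 * rho] `|`
  [set z : R | enorm (pt i z - pt j t) < 2 * rho])).
  by apply/measurableC/measurableU; exact: measurable_near_end.
apply/seteqP; split => z /=; rewrite !leNgt.
  by move=> [/negP h1 /negP h2] [].
by move=> h; split; apply/negP => h'; apply: h; [left|right].
Qed.

Let slice_eq i f1 f2 z : dot f1 f1 = 1 -> dot f2 f2 = 1 -> dot f1 f2 = 0 ->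
    dot f1 (V i) = 0 -> dot f2 (V i) = 0 -> 0 <= z <= t ->
  [set q : T1 * T1 |
    cell i (A i + (q.1 : R) *: f1 + (q.2 : R) *: f2 + z *: V i)] =
  slice_cell t A V i (pt i z) f1 f2.
Proof.
move=> f11 f22 f12 f1v f2v zt.
apply/seteqP; split => -[x y] /=; rewrite /cell /slice_cell /= dseg_frame// clamp_id//
  subrr expr0n addr0 (_ : pt i z + x *: f1 + y *: f2 = A i + x *: f1 + y *: f2 + z *: V i)//;
  by rewrite /axis_pt [RHS]addrAC [in RHS](addrAC (A i) (x *: f1)).
Qed.

(** The cell contains the open unit neighbourhood of the axis, and its normal
    slices at good points have the area of the hexagon instead of pi. *)
Lemma vol_cell_ge i :
  ((pi * (t + 4 / 3))%:E + (2 * Num.sqrt 3 - pi)%:E * leb (good i) <= vol (cell i))%E.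
Proof.
have [f1 [f2 [[f11 f22 f12 [f1v f2v]] FW]]] := vol_frame (A i) (VV i).
have [mc ->] := FW _ (measurable_cell i).
set C : set space := [set p | _].
have pi12 := @pi_le_sqrt12 R; have pi0 := pi_gt0 R; have r0 := @rho_gt0 R.
have r2 := @sqr_rho R.
pose g (z : R) := (pi * Num.max 0 (1 ^+ 2 - (z - clamp t z) ^+ 2))%:E.
have g0 z : (0 <= g z)%E by rewrite lee_fin mulr_ge0 ?pi_ge0// le_max lexx.
have mg : measurable_fun setT (g : T1 -> _).
  apply/measurable_EFinP; apply: measurable_funM => //.
  apply: measurable_maxr => //; exact: measurable_capsule_profile.
have d0 : 0 <= 2 * Num.sqrt 3 - pi :> R by rewrite subr_ge0.
have mgood := measurable_good i.
have -> : (pi * (t + 4 / 3))%:E = (\int[leb]_z g z)%E.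
  by rewrite integral_capsule// !expr1n mulr1 mul1r.
rewrite -(setIT (good i)) -(@integral_indic _ _ _ leb setT)//.
have mi : measurable_fun setT (fun z : T1 => (\1_(good i) z)%:E : \bar R).
  by apply/measurable_EFinP; exact: measurable_indic.
rewrite -ge0_integralZl_EFin//.
rewrite -ge0_integralD//; last 2 first.
- by move=> z _; rewrite mule_ge0// lee_fin.
- by apply: measurable_funeM.
rewrite vol3_slices//; apply: ge0_le_integral => //.
- by move=> z _; rewrite adde_ge0// mule_ge0// lee_fin.
- by apply: emeasurable_funD => //; exact: measurable_funeM.
- exact: measurable_slice_area.
move=> z _; rewrite indicE.
have mCz : measurable ([set q | C (q, z)] : set (T1 * T1)).
  have := @measurable_ysection _ _ _ _ C z mc.
  by congr measurable; apply/seteqP; split => q /=; rewrite /ysection/= inE.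
have [zg|zg] := boolP (z \in good i).
  move: zg; rewrite inE => -[zt far].
  have sE := slice_eq f11 f22 f12 f1v f2v zt.
  have mS : measurable (slice_cell t A V i (pt i z) f1 f2) by rewrite -sE.
  apply: le_trans (_ : _ <= (2 * Num.sqrt 3)%:E)%E _.
    rewrite mule1 /g clamp_id// subrr expr0n expr1n subr0 max_r// mulr1 -EFinD lee_fin.
    lra.
  by have := slice_area_ge tge0 VV sep zt far f11 f22 f12 mS; rewrite -sE.
rewrite mule0 adde0 /g -area_disc_lt; apply: le_measure; rewrite ?inE//.
  exact: measurable_open_disc.
move=> [x y] /= xy; have d1 : dseg t (A i) (V i)
   (A i + x *: f1 + y *: f2 + z *: V i) < 1.
  by rewrite dseg_frame//; move: xy; rewrite expr1n; lra.
rewrite /C /=; split => [|j ji]; first by rewrite r2; lra.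
have := dseg_lt1 (j := j) _ d1; rewrite eq_sym ji => /(_ isT); lra.
Qed.

(** Unit discs normal to the axes, centred at the points of the axes that are
    close to e, fill disjoint parts of a ball around e. *)
Lemma near_end_length e :
  (\sum_(i < n) leb [set z : R | (0 <= z <= t)%R /\ (enorm (pt i z - e) < 2 * rho)%R]
    <= (t0 R)%:E)%E.
Proof.
have r0 := @rho_gt0 R; have pi0 := pi_gt0 R.
pose Z i : set T1 := [set z : R | 0 <= z <= t /\ enorm (pt i z - e) < 2 * rho].
have mZ i : measurable (Z i).
  by apply: measurableI; [exact: measurable_axis_range|exact: measurable_near_end].
pose W i : set 'rV[R]_3 := [set x | dline (A i) (V i) x < 1 /\ Z i (height (A i) (V i) x)].
have mW i : measurable3 (W i).
  apply: measurableI.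
    by apply: measurable_set_lt => //; exact: measurable_fun3_dline.
  rewrite -[X in measurable X]setTI.
  by apply: (measurable_fun3_height (A i) (V i)) => //; exact: mZ.
have volW i : vol (W i) = (pi%:E * leb (Z i))%E.
  have [f1 [f2 [[f11 f22 f12 [f1v f2v]] FW]]] := vol_frame (A i) (VV i).
  have [_ ->] := FW _ (mW i).
  have -> : pi%:E = area [set q : T1 * T1 | ((q.1 : R) ^+ 2 + (q.2 : R) ^+ 2 < 1)%R].
    by rewrite area_disc_lt max_r// mulr1.
  set disc := [set q : T1 * T1 | _].
  have mdisc : measurable disc by exact: measurable_open_disc.
  transitivity (vol3 (disc `*` Z i)); last exact: (product_measure1E _ _ mdisc (mZ i)).
  congr (vol3 _); apply/seteqP; split => -[[x y] z] /=;
    by rewrite /W /= dline_frame// height_frame.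
have tW : trivIset setT W.
  apply/trivIsetP => i j _ _ ij; rewrite -subset0 => x [[di [zi _]] [dj [zj _]]].
  have := dseg_lt1 (i := i) (j := j) (x := x) ij.
  by rewrite !dsegE// di => /(_ isT); lra.
have sW : \big[setU/set0]_(i < n) (@vec3 R @^-1` W i : set space) `<=`
    @vec3 R @^-1` [set x | enorm (x - e) <= 2 * rho + 1].
  move=> p /bigsetU_ordP[i] /= [di [zi ei]].
  apply: (le_trans (enorm_dist _ (pt i (height (A i) (V i) (vec3 p))) _)).
  rewrite addrC; apply: lerD; first exact: ltW.
  by rewrite enorm_le// -dlineE// expr1n ltW.
have tW' : trivIset setT (fun i => @vec3 R @^-1` W i : set space).
  apply/trivIsetP => i j _ _ ij; rewrite -subset0 => p [Wi Wj].
  by have /trivIsetP/(_ i j I I ij) := tW; rewrite -subset0 => /(_ (vec3 p)); apply.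
have rr : 0 < 2 * rho + 1 :> R by lra.
have : (\sum_(i < n) vol (W i) <= (pi * (4 / 3 * (2 * rho + 1) ^+ 3))%:E)%E.
  rewrite -(vol_ball e rr).
  rewrite -(@measure_bigsetU_ord _ _ _ (@vol3 R) n xpredT _ mW tW').
  apply: le_measure => //; rewrite inE; first exact: measurable_bigsetU_ord.
  have -> : [set x | enorm (x - e) <= 2 * rho + 1] =
      [set x | dot (x - e) (x - e) <= (2 * rho + 1) ^+ 2].
    by apply/seteqP; split => x /=; rewrite enorm_le// ltW.
  exact: (measurable3_ball e ((2 * rho + 1) ^+ 2)).
have -> : (\sum_(i < n) vol (W i) = pi%:E * \sum_(i < n) leb (Z i))%E.
  rewrite ge0_sume_distrr; last by move=> i _; exact: measure_ge0.
  by apply: eq_bigr => i _; exact: volW.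
rewrite EFinM lee_pmul2l ?lte_fin//.
have -> : 4 / 3 * (2 * rho + 1) ^+ 3 = t0 R; last by [].
by rewrite /t0 /rho; congr (_ * (_ + _) ^+ 3); field; rewrite gt_eqF// sqrt3_gt0.
Qed.

(** A point of an axis that is not good is near one of the 2 n ends, and each
    end spoils a length of at most t0. *)
Lemma sum_good_ge :
  ((t *+ n)%:E <= \sum_(i < n) leb (good i) + (2 * t0 R *+ n)%:E)%E.
Proof.
pose Z i e : set T1 := [set z : R | 0 <= z <= t /\ enorm (pt i z - e) < 2 * rho].
have mZ i e : measurable (Z i e).
  by apply: measurableI; [exact: measurable_axis_range|exact: measurable_near_end].
have mgood := measurable_good.
have one i : (t%:E <= leb (good i) +
    \sum_(j < n) (leb (Z i (A j)) + leb (Z i (pt j t))))%E.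
  have -> : t%:E = leb [set z : R | (0 <= z <= t)%R].
    rewrite (_ : [set z | _] = `[0, t]%classic); last first.
      by apply/seteqP; split => z /=; rewrite in_itv.
    rewrite lebesgue_measure_itv/= lte_fin; case: ltP => [_|t00].
      by rewrite oppr0 adde0.
    by congr EFin; apply/eqP; rewrite eq_le t00 tge0.
  have mU j : measurable (Z i (A j) `|` Z i (pt j t)) by exact: measurableU.
  apply: (@le_trans _ _ (leb (good i `|` \big[setU/set0]_(j < n) (Z i (A j) `|` Z i (pt j t))))).
    apply: le_measure; rewrite ?inE//.
    - exact: measurable_axis_range.
    - by apply: measurableU => //; exact: measurable_bigsetU_ord.
    - move=> z zt; have [h|h] := pselect (exists j, (Z i (A j) `|` Z i (pt j t)) z).
        by right; apply/bigsetU_ordP.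
      left; split => // j; rewrite !leNgt; split; apply/negP => hz; apply: h; exists j.
        by left.
      by right.
  apply: (le_trans (measureU2 _ _ _)) => //; first exact: measurable_bigsetU_ord.
  rewrite leeD2l// (le_trans (measure_bigsetU_ord_le _ _))//.
  by apply: lee_sum => j _; exact: measureU2.
have -> : (t *+ n)%:E = (\sum_(i < n) t%:E)%E :> \bar R.
  by rewrite sumEFin sumr_const card_ord.
apply: (le_trans (lee_sum _ (fun i _ => one i))).
rewrite big_split /= leeD2l// exchange_big /=.
have -> : (2 * t0 R *+ n)%:E = (\sum_(j < n) ((t0 R)%:E + (t0 R)%:E))%E.
  by rewrite sumEFin sumr_const card_ord; congr ((_ *+ _)%:E); ring.
apply: lee_sum => j _; rewrite big_split /=.
by apply: leeD; exact: near_end_length.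
Qed.

End counting.


(** * The density bound *)

Section finite_packing.
Context {R : realType}.
Notation T1 := (measurableTypeR R).
Notation leb := (@lebesgue_measure R).
Notation space := (T1 * T1 * T1)%type.

(** The average volume that the truncated cells must have: hexagonal slices
    along a length t - 2 t0 of the axis, circular ones along the remaining
    length, and two half balls. *)
Definition cell_volume (t : R) : R :=
  2 * Num.sqrt 3 * (t - 2 * t0 R) + pi * (2 * t0 R) + pi * (4 / 3).

(** The truncated cells are disjoint and, as rho < 2, contained in the ball of
    radius r + 2. *)
Lemma finite_packing_bound n (t : R) (A V : 'I_n -> 'rV[R]_3) (r : R) :
    0 <= t -> (forall i, dot (V i) (V i) = 1) -> separated t A V -> 0 <= r ->
    (forall i s, 0 <= s <= t -> enorm (axis_pt A V i s) <= r) ->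
  cell_volume t *+ n <= pi * (4 / 3 * (r + 2) ^+ 3).
Proof.
move=> tge0 VV sep r0 inball.
have rho0 := @rho_gt0 R; have rho2 := @rho_lt2 R; have pi12 := @pi_le_sqrt12 R.
have mcell := measurable_cell t A V.
have rr : 0 < r + 2 by lra.
have tcell : trivIset setT (fun i => @vec3 R @^-1` cell t A V i : set space).
  apply/trivIsetP => i j _ _ ij; rewrite -subset0 => p [Wi Wj].
  have /trivIsetP/(_ i j I I ij) := trivIset_cell (t := t) (A := A) (V := V).
  by rewrite -subset0 => /(_ (vec3 p)); apply.
have h1 : (\sum_(i < n) vol (cell t A V i) <= (pi * (4 / 3 * (r + 2) ^+ 3))%:E)%E.
  rewrite -(vol_ball 0 rr).
  rewrite -(@measure_bigsetU_ord _ _ _ (@vol3 R) n xpredT _ mcell tcell).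
  apply: le_measure => //; rewrite ?inE.
  - exact: measurable_bigsetU_ord.
  - have -> : [set x : 'rV[R]_3 | enorm (x - 0) <= r + 2] =
        [set x | dot (x - 0) (x - 0) <= (r + 2) ^+ 2].
      by apply/seteqP; split => x /=; rewrite enorm_le// ltW.
    exact: measurable3_ball.
  - move=> p /bigsetU_ordP[i] /= [di _].
    have [s st dE] := @dseg_attained R t (A i) (V i) tge0 (VV i) (vec3 p).
    apply: (le_trans (enorm_dist _ (axis_pt A V i s) _)).
    rewrite subr0 addrC; apply: lerD; first exact: inball.
    apply: ltW; apply: lt_trans rho2.
    by rewrite enorm_lt ?(ltW rho0)// -dE.
have h2 : (\sum_(i < n) ((pi * (t + 4 / 3))%:E +
    (2 * Num.sqrt 3 - pi)%:E * leb (good t A V i)) <=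
    (pi * (4 / 3 * (r + 2) ^+ 3))%:E)%E.
  apply: le_trans h1; apply: lee_sum => i _; exact: vol_cell_ge.
have fin_good i : leb (good t A V i) \is a fin_num.
  rewrite ge0_fin_numE ?measure_ge0//.
  apply: (@le_lt_trans _ _ (leb `[0, t]%classic)).
    apply: le_measure; rewrite ?inE//; first exact: measurable_good.
    by move=> z [zt _] /=; rewrite in_itv.
  by rewrite lebesgue_measure_itv/=; case: ifP => _; rewrite ?oppr0 ?adde0 ltry.
have h3 := sum_good_ge tge0 VV sep.
pose g i := fine (leb (good t A V i)).
have gE i : leb (good t A V i) = (g i)%:E by rewrite fineK.
have {}h3 : t *+ n <= \sum_(i < n) g i + 2 * t0 R *+ n.
  rewrite -lee_fin EFinD -sumEFin (le_trans h3)// leeD2r//.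
  by apply: lee_sum => i _; rewrite gE.
have {}h2 : pi * (t + 4 / 3) *+ n + (2 * Num.sqrt 3 - pi) * \sum_(i < n) g i <=
    pi * (4 / 3 * (r + 2) ^+ 3).
  rewrite -lee_fin; apply: le_trans h2.
  have -> : pi * (t + 4 / 3) *+ n = \sum_(i < n) (pi * (t + 4 / 3)).
    by rewrite sumr_const card_ord.
  rewrite mulr_sumr -big_split /= -sumEFin; apply: lee_sum => i _.
  by rewrite gE -EFinM -EFinD.
apply: le_trans h2.
have e : cell_volume t *+ n = pi * (t + 4 / 3) *+ n +
    (2 * Num.sqrt 3 - pi) * (t *+ n - 2 * t0 R *+ n).
  rewrite -(mulr_natr (cell_volume t)) -(mulr_natr (pi * _)) -(mulr_natr t).
  rewrite -(mulr_natr (2 * t0 R)) /cell_volume.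
  by move: (t0 R) (pi : R) (Num.sqrt 3 : R) => u p q; ring.
rewrite e lerD2l ler_wpM2l ?subr_ge0//.
by rewrite lerBlDr.
Qed.

End finite_packing.

Section capped_cylinders.
Context {R : realType}.
Implicit Types (a b x y : 'rV[R]_3) (C : set 'rV[R]_3).

Lemma edist_segment t a v x : 0 <= t -> dot v v = 1 ->
  edist_set x (segment a (a + t *: v)) = Num.sqrt (dseg t a v x).
Proof.
move=> t0 vv; have [s st dE] := @dseg_attained R t a v t0 vv x.
set E := [set enorm (x - y) | y in segment a (a + t *: v)].
have inE0 : E (Num.sqrt (dseg t a v x)).
  exists (a + s *: v); last by rewrite dE enormE.
  have [t00|tn0] := eqVneq t 0.
    exists 0; first by rewrite /= in_itv/= lexx ler01.
    have -> : s = 0 by apply/eqP; move: st; rewrite t00 => /andP[h1 h2]; rewrite eq_le h1 h2.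
    by rewrite t00 !scale0r !addr0 subr0 scale1r.
  have tp : 0 < t by rewrite lt_neqAle eq_sym tn0.
  exists (s / t).
    by move: st; rewrite /= in_itv/= ler_pdivrMr// mul1r => /andP[h1 h2]; rewrite h2 divr_ge0.
  rewrite scalerDr scalerA divfK ?gt_eqF// addrA -scalerDl subrK scale1r //.
have lbE : lbound E (Num.sqrt (dseg t a v x)).
  move=> _ [y [u u01 <-] <-]; rewrite enormE ler_wsqrtr//.
  have -> : (1 - u) *: a + u *: (a + t *: v) = a + (u * t) *: v.
    by rewrite scalerDr scalerA addrA -scalerDl subrK scale1r.
  apply: dseg_le => //; move: u01; rewrite /= in_itv/= => /andP[u0 u1].
  by rewrite mulr_ge0//= ler_piMl.
apply/eqP; rewrite eq_le; apply/andP; split.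
  by apply: ge_inf => //; exists (Num.sqrt (dseg t a v x)).
by apply: lb_le_inf => //; exists (Num.sqrt (dseg t a v x)).
Qed.

Lemma capped_cylinderE t C : 0 < t -> is_capped_cylinder t C ->
  exists a v, dot v v = 1 /\ C = [set x | dseg t a v x <= 1].
Proof.
move=> tp [a [b [abt ->]]].
exists a, (t^-1 *: (b - a)); split.
  by rewrite dotZl dotZr -sqr_enorm abt; field; rewrite gt_eqF.
have vv : dot (t^-1 *: (b - a)) (t^-1 *: (b - a)) = 1.
  by rewrite dotZl dotZr -sqr_enorm abt; field; rewrite gt_eqF.
have bE : b = a + t *: (t^-1 *: (b - a)).
  by rewrite scalerA divff ?gt_eqF// scale1r addrC subrK.
have E x : edist_set x (segment a b) = Num.sqrt (dseg t a (t^-1 *: (b - a)) x).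
  by rewrite -edist_segment ?(ltW tp)// -bE.
apply/seteqP; split => x /=; rewrite E.
  by rewrite -[leRHS](sqrtr1) ler_sqrt.
by move=> dx; rewrite -[leRHS](sqrtr1) ler_sqrt.
Qed.

Lemma interior_capsule t a v s x : 0 <= t -> dot v v = 1 -> 0 <= s <= t ->
  enorm (x - (a + s *: v)) < 1 -> [set x | dseg t a v x <= 1]° x.
Proof.
move=> t0 vv st; set y := a + s *: v; rewrite enorm_lt// expr1n => xy.
pose f (z : 'rV[R]_3) : R := (z ord0 ord0 - y ord0 ord0) ^+ 2 +
    (z ord0 1 - y ord0 1) ^+ 2 + (z ord0 2%R - y ord0 2%R) ^+ 2.
have fE z : dot (z - y) (z - y) = f z by rewrite /f; clear; move: y => y; rewrite dotE !mxE !expr2.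
have cf : {for x, continuous f}.
  have cc (i : 'I_3) : {for x, continuous (fun z : 'rV[R]_3 => (z ord0 i - y ord0 i) ^+ 2)}.
    apply: (@continuous_comp _ _ _ (fun z : 'rV[R]_3 => z ord0 i - y ord0 i) (fun u : R => u ^+ 2)).
      by apply: cvgB; [exact: nbhs_filter|exact: coord_continuous|apply: cvg_cst; exact: nbhs_filter].
    exact: exprn_continuous.
  apply: cvgD; [exact: nbhs_filter|apply: cvgD; [exact: nbhs_filter|exact: cc|exact: cc]|exact: cc].
rewrite fE in xy; rewrite /interior /=.
have := @cvgr_lt R _ (nbhs x) (nbhs_filter x) f (f x) cf 1 xy.
apply: filterS => z; rewrite -fE => zy.
exact: (le_trans (dseg_le a vv z st) (ltW zy)).
Qed.

End capped_cylinders.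


Section density.
Context {R : realType}.

Lemma t0_gt0 : 0 < t0 R.
Proof.
by rewrite /t0 mulr_gt0 ?divr_gt0// exprn_gt0// addr_gt0// divr_gt0 ?sqrtr_gt0.
Qed.

Lemma cell_volume_gt0 t : 2 * t0 R <= t -> 0 < cell_volume t.
Proof.
move=> h; have t00 := t0_gt0; have p0 := pi_gt0 R; have s3 := @sqrt3_gt0 R.
have a1 : 0 <= 2 * Num.sqrt 3 * (t - 2 * t0 R) by rewrite mulr_ge0 ?subr_ge0// mulr_ge0// ltW.
have a2 : 0 < pi * (2 * t0 R) by rewrite !mulr_gt0.
have a3 : 0 < pi * (4 / 3) :> R by rewrite mulr_gt0// divr_gt0.
by rewrite /cell_volume; lra.
Qed.

Lemma sqrt12E : Num.sqrt 12 = 2 * Num.sqrt 3 :> R.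
Proof.
rewrite (_ : 12 = 2 ^+ 2 * 3); last by ring.
by rewrite sqrtrM ?sqr_ge0// sqrtr_sqr ger0_norm.
Qed.

Lemma eballE r : eball r = [set x : 'rV[R]_3 | enorm (x - 0) <= r].
Proof. by apply/seteqP; split => x /=; rewrite subr0. Qed.

(** Two axes at distance less than 2 would have the midpoint of a shortest
    connecting segment in the interiors of both cylinders. *)
Lemma finite_density_bound t (I : countType) (C : I -> set 'rV[R]_3) (s : seq I) r :
    0 < t -> is_packing t C -> 0 < r -> uniq s ->
    (forall i, i \in s -> C i `<=` eball r) ->
  cell_volume t *+ size s <= pi * (4 / 3 * (r + 2) ^+ 3).
Proof.
move=> tp [cyl disj] rp us sB.
have /choice[av avP] : forall i, exists av : 'rV[R]_3 * 'rV[R]_3,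
    dot av.2 av.2 = 1 /\ C i = [set x | dseg t av.1 av.2 x <= 1].
  move=> i; have [a [v [vv Ci]]] := capped_cylinderE tp (cyl i).
  by exists (a, v).
pose A (k : 'I_(size s)) := (av (tnth (in_tuple s) k)).1.
pose V (k : 'I_(size s)) := (av (tnth (in_tuple s) k)).2.
have VV k : dot (V k) (V k) = 1 by have [] := avP (tnth (in_tuple s) k).
have CE k : C (tnth (in_tuple s) k) = [set x | dseg t (A k) (V k) x <= 1].
  by have [] := avP (tnth (in_tuple s) k).
apply: (@finite_packing_bound R (size s) t A V r (ltW tp) VV _ (ltW rp)).
- move=> i j u w ij ut wt; rewrite leNgt; apply/negP => close.
  pose x := axis_pt A V i u; pose y := axis_pt A V j w.
  pose m := x + 2^-1 *: (y - x).
  have half z : enorm (2^-1 *: z) = enorm z / 2 :> R.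
    rewrite !enormE dotZl dotZr mulrA -expr2 sqrtrM ?sqr_ge0// sqrtr_sqr.
    by rewrite ger0_norm ?invr_ge0// mulrC.
  have mx : enorm (m - x) < 1.
    rewrite /m addrAC subrr add0r half enormB ltr_pdivrMr// mul1r.
    exact: close.
  have my : enorm (m - y) < 1.
    have -> : m - y = 2^-1 *: (x - y).
      have mid (x' y' : 'rV[R]_3) : x' + 2^-1 *: (y' - x') - y' = 2^-1 *: (x' - y').
        by apply/rowP => k; rewrite !mxE; field.
      exact: mid.
    by rewrite half ltr_pdivrMr// mul1r; exact: close.
  have Ii : (C (tnth (in_tuple s) i))° m.
    by rewrite CE; apply: interior_capsule mx => //; exact: ltW.
  have Ij : (C (tnth (in_tuple s) j))° m.
    by rewrite CE; apply: interior_capsule my => //; exact: ltW.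
  have /trivIsetP /(_ (tnth (in_tuple s) i) (tnth (in_tuple s) j) Logic.I Logic.I) := disj.
  have -> : tnth (in_tuple s) i != tnth (in_tuple s) j.
    have inj : injective (tnth (in_tuple s)) by apply/tuple_uniqP.
    by rewrite (inj_eq inj).
  by move=> /(_ isT); rewrite -subset0 => /(_ m); apply.
- move=> k u ut.
  have := sB _ (mem_tnth k (in_tuple s)) (axis_pt A V k u); apply.
  rewrite CE /=; apply: le_trans (dseg_le (A k) (VV k) _ ut) _.
  by rewrite subrr -[dot 0 0]sqr_enorm /enorm; under eq_bigr do rewrite mxE expr0n /=; rewrite big1// sqrtr0 expr0n.
Qed.

Lemma growth_bound (K e r : R) : 0 <= K -> 0 < e -> 1 <= r -> 26 * K / e <= r ->
  K * ((r + 2) / r) ^+ 3 <= K + e.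
Proof.
move=> K0 e0 r1 Kr; have r0 : 0 < r by lra.
have -> : (r + 2) / r = 1 + 2 / r by field; rewrite gt_eqF.
set u := 2 / r.
have u0 : 0 <= u by rewrite divr_ge0// ltW.
have u2 : u <= 2 by rewrite /u ler_pdivrMr//; lra.
(* for u <= 2, u ^ 2 <= 2 u and u ^ 3 <= 4 u; and 13 * 2 = 26 *)
have h : (1 + u) ^+ 3 <= 1 + 13 * u.
  have -> : (1 + u) ^+ 3 = 1 + 3 * u + 3 * (u * u) + u * (u * u) by ring.
  have uu : u * u <= 2 * u by rewrite ler_wpM2r.
  have uuu : u * (u * u) <= 2 * (2 * u).
    by apply: ler_pM => //; rewrite mulr_ge0.
  lra.
apply: (le_trans (ler_wpM2l K0 h)); rewrite mulrDr mulr1 lerD2l /u.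
have -> : K * (13 * (2 / r)) = 26 * K / r by field; rewrite gt_eqF.
by rewrite ler_pdivrMr// [e * r]mulrC -ler_pdivrMr.
Qed.

End density.

Unset Implicit Arguments.

Theorem corollary2 (R : realType) (t : R) (ht : 2 * t0 R <= t)
  (I : countType) (C : I -> set 'rV[R]_3) (hC : is_packing t C) :
  (upper_density C <=
    ((t + 4 / 3) /
     (Num.sqrt 12 / pi * (t - 2 * t0 R) + 2 * t0 R + 4 / 3))%:E)%E.
Proof.
have t00 := @t0_gt0 R; have tp : 0 < t by lra.
have pi0 := pi_gt0 R; have W0 := cell_volume_gt0 ht.
set K := (X in (_ <= X%:E)%E).
have KE : K = pi * (t + 4 / 3) / cell_volume t.
  have -> : cell_volume t =
      pi * (Num.sqrt 12 / pi * (t - 2 * t0 R) + 2 * t0 R + 4 / 3).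
    rewrite /cell_volume sqrt12E; move: (pi : R) pi0 => p p0.
    by field; rewrite gt_eqF.
  by rewrite -[RHS]mulf_div divff ?gt_eqF// mul1r.
have K0 : 0 <= K by rewrite KE divr_ge0 ?(ltW W0)// mulr_ge0 ?(ltW pi0)//; lra.
apply/lee_addgt0Pr => e e0.
apply: ge_ereal_inf.
pose M := Num.max 1 (26 * K / e).
exists (ereal_sup ((fun r : R => \esum_(i in [set i | C i `<=` eball r])
                     (vol (C i) / vol (eball r))%E) @` [set r | M < r])).
  by exists [set r | M < r] => //; apply: nbhs_pinfty_gt; exact: num_real.
apply: ge_ereal_sup => _ [r Mr <-].
have [M1 Me] : 1 <= M /\ 26 * K / e <= M by rewrite !le_max !lexx orbT.
have r1 : 1 <= r by rewrite (le_trans M1)// ltW.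
have r0 : 0 < r by lra.
have volE i : (vol (C i) / vol (eball r))%E =
    (pi * (t + 4 / 3) / (pi * (4 / 3 * r ^+ 3)))%:E.
  have [a [v [vv ->]]] := capped_cylinderE tp (hC.1 i).
  rewrite vol_capsule ?(ltW tp)// eballE vol_ball// inver gt_eqF//.
  by rewrite !mulr_gt0// exprn_gt0.
(* the sum over all cylinders in the ball is the supremum of its finite parts *)
apply: ge_ereal_sup => _ [X [finX XB] <-].
rewrite fsbig_finite//=.
under eq_bigr do rewrite volE.
rewrite sumEFin -EFinD lee_fin big_const_seq count_predT iter_addr_0.
set n := size _.
have bound : cell_volume t *+ n <= pi * (4 / 3 * (r + 2) ^+ 3).
  apply: (finite_density_bound tp hC r0); first exact: finmap.fset_uniq.
  by move=> i; rewrite in_fset_set// inE => /XB.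
apply: le_trans (growth_bound K0 e0 r1 (le_trans Me (ltW Mr))).
rewrite KE -(mulr_natr (_ / _)).
move: bound; rewrite -(mulr_natr (cell_volume t)); set N := n%:R => bound.
have b0 : 0 < pi * (4 / 3 * r ^+ 3) by rewrite !mulr_gt0// exprn_gt0.
have V0 : 0 <= pi * (t + 4 / 3) by rewrite mulr_ge0 ?(ltW pi0)//; lra.
have -> : pi * (t + 4 / 3) / cell_volume t * ((r + 2) / r) ^+ 3 =
  pi * (t + 4 / 3) / (pi * (4 / 3 * r ^+ 3)) *
  (pi * (4 / 3 * (r + 2) ^+ 3) / cell_volume t).
  move: (pi : R) pi0 (cell_volume t) W0 => p p0 w w0.
  by field; rewrite !gt_eqF.
rewrite ler_wpM2l ?divr_ge0 ?(ltW b0)//.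
by rewrite ler_pdivlMr// mulrC.
Qed.
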